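(* For each $\lambda\in M$, the sequence $G_{n,\lambda}$ converges uniformly on $\mathbb{C}^{k+1}$ to a continuous plurisubharmonic function $G_\lambda$ (with values in $[-\infty,\infty)$) which satisfies $$G_\lambda(cx)=\log|c|+G_\lambda(x)$$ for $c\in\mathbb{C}^*$ and $x\in\mathbb{C}^{k+1}$. Further, $d\,G_\lambda=G_{\sigma(\lambda)}\circ F_\lambda$, and $G_{\lambda_n}\to G_\lambda$ locally uniformly on $\mathbb{C}^{k+1}\setminus\{0\}$ as $\lambda_n\to\lambda$ in $M$. Finally, $$\mathcal{A}_\lambda=\{x\in\mathbb{C}^{k+1}:\ G_\lambda(x)<0\}$$ for each $\lambda\in M$.
   Context: $M$ is a compact metric space, $\sigma:M\to M$ is continuous, and for each $\lambda\in M$, $f_\lambda$ is a holomorphic endomorphism of $\mathbb{P}^k$ of fixed degree $d\ge2$ depending continuously on $\lambda$. Let $F_\lambda:\mathbb{C}^{k+1}\to\mathbb{C}^{k+1}$ be a non-degenerate ($F_\lambda^{-1}(0)=\{0\}$) homogeneous holomorphic map of degree $d$, depending continuously on $\lambda\in M$, with $\pi\circ F_\lambda=f_\lambda\circ\pi$, where $\pi:\mathbb{C}^{k+1}\setminus\{0\}\to\mathbb{P}^k$ is the canonical projection. In particular there are constants $l,L>0$ with $l\|x\|^d\le\|F_\lambda(x)\|\le L\|x\|^d$ for all $\lambda\in M$, $x\in\mathbb{C}^{k+1}$. For $\lambda\in M$ and $n\ge1$ let $$G_{n,\lambda}(x)=\frac1{d^n}\log\|F_{\sigma^{n-1}(\lambda)}\circ\cdots\circ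 F_{\sigma(\lambda)}\circ F_\lambda(x)\|$$ (with value $-\infty$ at $x=0$), and $$\mathcal{A}_\lambda=\{x\in\mathbb{C}^{k+1}:\ F_{\sigma^{n-1}(\lambda)}\circ\cdots\circ F_{\sigma(\lambda)}\circ F_\lambda(x)\to0\text{ as }n\to\infty\}.$$ *)

(* Defs.v *)
From HB Require Import structures.
From mathcomp Require Import all_boot all_order all_algebra generic_quotient.
From mathcomp Require Import complex.
From mathcomp Require Import all_classical all_reals all_analysis.
Import Order.TTheory GRing.Theory Num.Theory.
Import numFieldNormedType.Exports.

Set Implicit Arguments.
Unset Strict Implicit.
Unset Printing Implicit Defensive.

Local Open Scope classical_set_scope.
Local Open Scope ring_scope.
Local Open Scope quotient_scope.

(* R[i] as a normed module over itself; without these instances the topology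
   is only found on the alias R[i]^o. *)
#[warning="-redundant-canonical-projection"]
HB.instance Definition _ (R : realType) := GRing.ComAlgebra.copy R[i] R[i]^o.
#[warning="-redundant-canonical-projection"]
HB.instance Definition _ (R : realType) := Vector.copy R[i] R[i]^o.
#[warning="-redundant-canonical-projection"]
HB.instance Definition _ (R : realType) := NormedModule.copy R[i] R[i]^o.

Notation "''CV[' R ]_ n" := 'rV[R[i]]_n
  (at level 0, R at level 2, n at level 2, format "''CV[' R ]_ n").

(* Modulus of a complex number and Euclidean norm on C^n, as elements of R
   (the MathComp norm of R[i] is R[i]-valued). *)
Definition cmod (R : realType) (c : R[i]) : R := Normc.normc c.

Definition enorm (R : realType) n (x : 'CV[R]_n) : R :=
  Num.sqrt (\sum_(i < n) cmod (x 0 i) ^+ 2).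

Definition holomorphic (R : realType) m n (F : 'CV[R]_m -> 'CV[R]_n) : Prop :=
  forall x, differentiable F x.

Definition homogeneous_map (R : realType) m n (d : nat)
    (F : 'CV[R]_m -> 'CV[R]_n) : Prop :=
  forall (c : R[i]) x, F (c *: x) = c ^+ d *: F x.

Definition nondegenerate (R : realType) m n (F : 'CV[R]_m -> 'CV[R]_n) : Prop :=
  F @^-1` [set 0] = [set 0].

Section ProjectiveSpace.
Context (R : realType) (k : nat).

(* C^(k+1) \ {0}, with the subspace topology *)
Definition nzvec : topologicalType :=
  set_type [set x : 'CV[R]_k.+1 | x != 0].

Definition nzval (x : nzvec) : 'CV[R]_k.+1 := set_val x.

Definition proj_rel (x y : nzvec) : bool :=
  `[< exists2 c : R[i], c != 0 & nzval x = c *: nzval y >].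

Lemma proj_rel_refl : reflexive proj_rel.
Proof. by move=> x; apply/asboolP; exists 1; rewrite ?oner_eq0// scale1r. Qed.

Lemma proj_rel_sym : symmetric proj_rel.
Proof.
have H x y : proj_rel x y -> proj_rel y x.
  move=> /asboolP[c c0 xy]; apply/asboolP; exists c^-1; first by rewrite invr_eq0.
  by rewrite xy scalerA mulVf// scale1r.
by move=> x y; apply/idP/idP; exact: H.
Qed.

Lemma proj_rel_trans : transitive proj_rel.
Proof.
move=> y x z /asboolP[c c0 xy] /asboolP[e e0 yz]; apply/asboolP; exists (c * e).
  by rewrite mulf_neq0.
by rewrite xy yz scalerA.
Qed.

Canonical proj_equiv : equiv_rel nzvec :=
  EquivRel proj_rel proj_rel_refl proj_rel_sym proj_rel_trans.

Definition proj_space : topologicalType := quotient_topology {eq_quot proj_equiv}.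

Definition pi_proj (x : nzvec) : proj_space := \pi_({eq_quot proj_equiv}) x.

(* The affine chart {x_j <> 0} -> C^k, [x] |-> (x_l / x_j)_(l <> j); only
   meaningful on its domain. *)
Definition affine_dom (j : 'I_k.+1) : set proj_space :=
  [set p | nzval (repr p) 0 j != 0].

Definition affine_chart (j : 'I_k.+1) (p : proj_space) : 'CV[R]_k :=
  \row_l (nzval (repr p) 0 (lift j l) / nzval (repr p) 0 j).

(* The inverse chart: insert 1 at position j. *)
Definition affine_vec (j : 'I_k.+1) (z : 'CV[R]_k) : 'CV[R]_k.+1 :=
  \row_i (if unlift j i is Some l then z 0 l else 1).

Lemma affine_vec_neq0 j z : affine_vec j z != 0.
Proof.
apply/eqP => /rowP/(_ j); rewrite !mxE unlift_none => /eqP.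
by rewrite oner_eq0.
Qed.

Definition affine_point (j : 'I_k.+1) (z : 'CV[R]_k) : proj_space :=
  pi_proj (exist _ (affine_vec j z) (mem_set (affine_vec_neq0 j z))).

Definition proj_holomorphic (f : proj_space -> proj_space) : Prop :=
  continuous f /\
  forall (i j : 'I_k.+1) (z : 'CV[R]_k), affine_dom j (f (affine_point i z)) ->
    differentiable (affine_chart j \o f \o affine_point i) z.

(* The last clause is pi \o F = f \o pi on C^(k+1) \ {0}. *)
Definition homogeneous_lift (d : nat) (F : 'CV[R]_k.+1 -> 'CV[R]_k.+1)
    (f : proj_space -> proj_space) : Prop :=
  [/\ holomorphic F, homogeneous_map d F, nondegenerate F &
      forall x y : nzvec, nzval y = F (nzval x) -> pi_proj y = f (pi_proj x)].

(* d is the algebraic degree, i.e. the degree of a homogeneous lift. *)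
Definition holomorphic_endomorphism (d : nat)
    (f : proj_space -> proj_space) : Prop :=
  proj_holomorphic f /\ exists F, homogeneous_lift d F f.

End ProjectiveSpace.

Section NonautonomousGreen.
Context (R : realType) (M : Type) (k : nat) (d : nat) (sigma : M -> M).
Context (F : M -> 'CV[R]_k.+1 -> 'CV[R]_k.+1).

(* F_(sigma^(n-1) l) \o ... \o F_(sigma l) \o F_l *)
Fixpoint fiber_iter (n : nat) (l : M) (x : 'CV[R]_k.+1) : 'CV[R]_k.+1 :=
  if n is m.+1 then F (iter m sigma l) (fiber_iter m l x) else x.

Definition Gn (n : nat) (l : M) (x : 'CV[R]_k.+1) : \bar R :=
  (((d ^ n)%:R : R)^-1%:E * lne (enorm (fiber_iter n l x))%:E)%E.

Definition basin0 (l : M) : set 'CV[R]_k.+1 :=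
  [set x | fiber_iter n l x @[n --> \oo] --> (0 : 'CV[R]_k.+1)].

End NonautonomousGreen.

(* Uniform convergence on A with respect to |a - b|, where |-oo - -oo| = 0 and
   a finite value is at infinite distance from -oo. This is finer than the
   uniformity that MathComp-Analysis puts on \bar R, which is bounded. *)
Definition uniform_cvg_on (R : realType) (T : Type) (A : set T)
    (u : nat -> T -> \bar R) (g : T -> \bar R) : Prop :=
  forall e : R, 0 < e -> \forall n \near \oo, forall x, A x ->
    (g x - e%:E <= u n x /\ u n x <= g x + e%:E)%E.

Definition locally_uniform_cvg_on (R : realType) (T : topologicalType)
    (A : set T) (u : nat -> T -> \bar R) (g : T -> \bar R) : Prop :=
  forall x, A x -> exists2 U, nbhs x U & uniform_cvg_on (U `&` A) u g.

Definition expit (R : realType) (t : R) : R[i] := (cos t +i* sin t)%C.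

(* Plurisubharmonic on C^n with values in [-oo, +oo[: upper semicontinuous, and
   bounded by its circle means in every complex line. The integrand is bounded
   above, so the integral is well defined in [-oo, +oo[. *)
Definition plurisubharmonic (R : realType) n (u : 'CV[R]_n -> \bar R) : Prop :=
  [/\ forall x, (u x < +oo)%E,
      lower_semicontinuous (fun x => - u x)%E &
      forall z w : 'CV[R]_n,
        (u z <= ((2 * pi)^-1 : R)%:E *
           \int[lebesgue_measure]_(t in `[0%R, (2 * pi)%R]%classic)
             u (z + expit t *: w)%R)%E].

(* Main.v *)
Require Import Defs.
From mathcomp Require Import all_boot all_order all_algebra.
From mathcomp Require Import complex.
From mathcomp Require Import all_classical all_reals all_analysis.
From mathcomp Require Import ring lra.
Import Order.TTheory GRing.Theory Num.Theory.
Import numFieldNormedType.Exports.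

Set Implicit Arguments.
Unset Strict Implicit.
Unset Printing Implicit Defensive.

Local Open Scope classical_set_scope.
Local Open Scope ring_scope.

(** By compactness of M and of the unit sphere, homogeneity and nondegeneracy
    give a constant C with | log||F_l(x)|| - d log||x|| | <= C for all l and all
    x <> 0 (ln_lift_bound). Applied at the n-th point of the orbit of x and
    divided by d^(n+1), this says that G_(n+1) and G_n differ by at most
    C / d^(n+1), uniformly in l and x. Hence the G_n converge, with error at
    most C / d^n, to a function that is finite off the origin (green,
    green_near). Every identity and every continuity property of the G_n that is
    uniform in n passes to the limit: homogeneity (greenZ), invariance
    (green_invariant) and joint continuity in (l, x) (green_continuous). By
    homogeneity G_l' - G_l only depends on the direction of x, so that joint
    continuity and compactness of the sphere give uniform convergence as l' -> l
    (green_unif_near). Multiplying the error estimate by d^n, the norm of the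
    n-th iterate is exp(d^n G_l(x)) up to a factor exp(C), and this tells when
    it tends to 0 (green_basin).

    Plurisubharmonicity holds because G_l is a uniform limit of functions
    (log||H||) / m with H holomorphic (plurisubharmonic_log_limit). Holomorphic
    only means complex differentiable at every point, so the subharmonicity of
    log||H|| on complex lines starts from Goursat's lemma. The chain is:

    - Goursat's bisection argument, for a real form P ds + Q dt that is
      differentiable and closed at each point (loop_integral_eq0).
    - For an entire h, the form Im h(e^(s+it)) ds + Re h(e^(s+it)) dt is closed
      and 2 pi-periodic in t, so the integral of Re h over the circle of radius
      e^s does not depend on s. Letting s tend to -oo gives the mean value
      property at 0 (mean_Re), and then the maximum principle in the form that
      |h(0)| is at most the maximum of |h| on the unit circle
      (cmod_le_circle).
    - If |h| <= exp(Phi) on the unit circle, with Phi continuous, then |h(0)| is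
      at most the exponential of the mean of Phi (le_exp_mean). The maximum
      principle is applied to the product of the rotated functions h(w^j z),
      where w is a primitive N-th root of unity: its value at 0 is h(0)^N, and
      on the circle its modulus is at most the exponential of a Riemann sum of
      Phi. This yields the submean inequality for log|h| without any
      factorization of h, and zeros of h on the circle cause no difficulty.
    - For vector-valued maps one pairs with the unit vector in the direction of
      the value at the centre (enorm_le_exp_mean).

    The continuous majorants Phi are the truncations max(G_l, -K) plus a small
    constant; letting K tend to infinity, monotone convergence gives the submean
    inequality for G_l itself, including on circles through the origin, where
    G_l takes the value -oo (integral_ge_truncate). *)

(** * Euclidean topology of C and C^n *)

Lemma cmodE (R : realType) (z : R[i]) : `|z| = (cmod z)%:C%C.
Proof. by []. Qed.

Lemma cmod_ge0 (R : realType) (z : R[i]) : 0 <= cmod z.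
Proof. by case: z => a b; rewrite sqrtr_ge0. Qed.

Lemma cmodM (R : realType) (z w : R[i]) : cmod (z * w) = cmod z * cmod w.
Proof. exact: Normc.normcM. Qed.

Lemma cmod0 (R : realType) : cmod (0 : R[i]) = 0.
Proof. exact: Normc.normc0. Qed.

Lemma cmod1 (R : realType) : cmod (1 : R[i]) = 1.
Proof. exact: Normc.normc1. Qed.

Lemma cmodX (R : realType) (z : R[i]) n : cmod (z ^+ n) = cmod z ^+ n.
Proof. by elim: n => [|n IH]; rewrite ?cmod1// !exprS cmodM IH. Qed.

Lemma cmodN (R : realType) (z : R[i]) : cmod (- z) = cmod z.
Proof. exact: normcN. Qed.

Lemma cmodD (R : realType) (z w : R[i]) : cmod (z + w) <= cmod z + cmod w.
Proof. exact: le_normcD. Qed.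

Lemma cmodBC (R : realType) (z w : R[i]) : cmod (z - w) = cmod (w - z).
Proof. by rewrite -opprB cmodN. Qed.

Lemma cmod_gt0 (R : realType) (z : R[i]) : (0 < cmod z) = (z != 0).
Proof.
rewrite lt_neqAle cmod_ge0 andbT eq_sym; apply/idP/idP; apply: contra.
  by move=> /eqP ->; rewrite cmod0.
by move=> /eqP /Normc.eq0_normc ->.
Qed.

Lemma cmod_real (R : realType) (r : R) : cmod (r%:C)%C = `|r|.
Proof. by rewrite /cmod /Normc.normc /= expr0n addr0 sqrtr_sqr. Qed.

Lemma Re_le_cmod (R : realType) (z : R[i]) : `|complex.Re z| <= cmod z.
Proof.
case: z => a b; rewrite /cmod /= -sqrtr_sqr ler_wsqrtr// lerDl sqr_ge0//.
Qed.

Lemma Im_le_cmod (R : realType) (z : R[i]) : `|complex.Im z| <= cmod z.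
Proof.
case: z => a b; rewrite /cmod /= -sqrtr_sqr ler_wsqrtr// lerDr sqr_ge0//.
Qed.

Lemma cmod_le (R : realType) (a b : R) : cmod (a +i* b)%C <= `|a| + `|b|.
Proof.
rewrite /cmod /= -[leRHS]ger0_norm ?addr_ge0// -sqrtr_sqr ler_wsqrtr//.
rewrite sqrrD !real_normK ?num_real// lerD2r lerDl.
by rewrite mulrn_wge0// mulr_ge0.
Qed.

Lemma cmod_prod (R : realType) (I : Type) (r : seq I) (f : I -> R[i]) :
  cmod (\prod_(i <- r) f i) = \prod_(i <- r) cmod (f i).
Proof. by apply: big_morph; [exact: cmodM|rewrite cmod1]. Qed.

Lemma cmodJ (R : realType) (z : R[i]) : cmod z^*%C = cmod z.
Proof. by case: z => a b; rewrite /cmod /= sqrrN. Qed.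

Lemma cmod_sum (R : realType) (I : Type) (r : seq I) (f : I -> R[i]) :
  cmod (\sum_(i <- r) f i) <= \sum_(i <- r) cmod (f i).
Proof.
elim: r => [|i r IH]; first by rewrite !big_nil cmod0.
by rewrite !big_cons (le_trans (cmodD _ _))// lerD2l.
Qed.

(** The norm of R[i] takes its values in R[i], so its balls have complex radii;
    this brings neighbourhoods back to real radii. *)
Lemma nbhs_cmodP (R : realType) (x : R[i]) (P : set R[i]) :
  nbhs x P <-> exists2 e : R, 0 < e & forall y, cmod (y - x) < e -> P y.
Proof.
split.
  move=> /nbhs_normP[e /= e0 eP].
  move: e0; rewrite ltcE /= => /andP[/eqP Ie Re0].
  exists (complex.Re e) => // y yx; apply: eP; rewrite /= distrC cmodE ltcE /=.
  by rewrite Ie eqxx.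
move=> [e e0 eP]; apply/nbhs_normP; exists (e%:C%C) => /=.
  by rewrite ltcE /= eqxx.
by move=> y /=; rewrite distrC cmodE ltcE /= => /andP[_ ?]; exact: eP.
Qed.

Lemma cmod_continuous (R : realType) : continuous (@cmod R).
Proof.
move=> x P /nbhs_normP[e /= e0 eP]; apply/nbhs_cmodP; exists e => // y yx.
apply: eP; rewrite /= (le_lt_trans _ yx)// ler_distlC.
have h (a b : R[i]) : cmod a - cmod b <= cmod (a - b).
  by rewrite lerBlDr (le_trans _ (cmodD _ _))// subrK.
have := h x y; have := h y x; rewrite (cmodBC x y).
by move=> *; apply/andP; split; lra.
Qed.

Lemma Re_continuous (R : realType) : continuous (@complex.Re R : R[i] -> R).
Proof.
move=> z P /nbhs_normP[e /= e0 eP]; apply/nbhs_cmodP; exists e => // y yx.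
apply: eP; rewrite /= (le_lt_trans _ yx)// distrC.
by apply: le_trans (Re_le_cmod (y - z)); case: y z {yx} => a b [c f].
Qed.

Lemma Im_continuous (R : realType) : continuous (@complex.Im R : R[i] -> R).
Proof.
move=> z P /nbhs_normP[e /= e0 eP]; apply/nbhs_cmodP; exists e => // y yx.
apply: eP; rewrite /= (le_lt_trans _ yx)// distrC.
by apply: le_trans (Im_le_cmod (y - z)); case: y z {yx} => a b [c f].
Qed.

Lemma complex_continuous (R : realType) (T : topologicalType) (f g : T -> R) (x : T) :
  continuous_at x f -> continuous_at x g ->
  continuous_at x (fun y => (f y +i* g y)%C : R[i]).
Proof.
move=> cf cg P /nbhs_cmodP[e e0 eP].
have e20 : 0 < e / 2 by rewrite divr_gt0.
move/cvgrPdist_lt : cf => /(_ _ e20); move/cvgrPdist_lt : cg => /(_ _ e20).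
apply: filterS2 => y h1 h2; apply: eP; apply: (le_lt_trans (cmod_le _ _)).
by rewrite -[_ - f x]opprB -[_ - g x]opprB !normrN; lra.
Qed.

Lemma enorm_ge0 (R : realType) n (x : 'CV[R]_n) : 0 <= enorm x.
Proof. exact: sqrtr_ge0. Qed.

Lemma cmod_le_enorm (R : realType) n (x : 'CV[R]_n) i : cmod (x 0 i) <= enorm x.
Proof.
have -> : cmod (x 0 i) = Num.sqrt (cmod (x 0 i) ^+ 2).
  by rewrite sqrtr_sqr ger0_norm ?cmod_ge0.
rewrite ler_wsqrtr// (bigD1 i)//= lerDl sumr_ge0// => j _.
by rewrite sqr_ge0.
Qed.

Lemma enorm_le_sum (R : realType) n (x : 'CV[R]_n) :
  enorm x <= \sum_(i < n) cmod (x 0 i).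
Proof.
have S0 : 0 <= \sum_(i < n) cmod (x 0 i) by apply: sumr_ge0 => i _; exact: cmod_ge0.
rewrite -[leRHS](ger0_norm S0) -sqrtr_sqr ler_wsqrtr//.
rewrite [leRHS]expr2 mulr_suml ler_sum// => i _.
rewrite expr2 ler_wpM2l ?cmod_ge0// (bigD1 i)//= lerDl sumr_ge0// => j _.
exact: cmod_ge0.
Qed.

Lemma enormZ (R : realType) n (c : R[i]) (x : 'CV[R]_n) :
  enorm (c *: x) = cmod c * enorm x.
Proof.
rewrite /enorm; under eq_bigr do rewrite mxE cmodM exprMn.
by rewrite -mulr_sumr sqrtrM ?sqr_ge0// sqrtr_sqr ger0_norm ?cmod_ge0.
Qed.

Lemma enorm_gt0 (R : realType) n (x : 'CV[R]_n) : (0 < enorm x) = (x != 0).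
Proof.
apply/idP/idP.
  apply: contraTneq => ->; rewrite /enorm big1 ?sqrtr0 ?ltxx// => i _.
  by rewrite mxE cmod0 expr0n.
move=> x0; have [i xi0] : exists i, x 0 i != 0.
  apply: contrapT => /forallNP xi; move/negP: x0; apply; apply/eqP/rowP => i.
  by rewrite mxE; apply/eqP; rewrite -[_ == _]negbK; apply/negP; exact: xi.
by rewrite (lt_le_trans _ (cmod_le_enorm x i))// cmod_gt0.
Qed.

Lemma enorm0 (R : realType) n : enorm (0 : 'CV[R]_n) = 0.
Proof. by apply/eqP; rewrite eq_le enorm_ge0 andbT leNgt enorm_gt0 eqxx. Qed.

(** The library topology comes from the maximum norm; it agrees with the
    Euclidean one because the maximum of the moduli is at most the Euclidean
    norm, which is at most their sum. *)
Lemma nbhs_enormP (R : realType) n (x : 'CV[R]_n) (P : set 'CV[R]_n) :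
  nbhs x P <-> exists2 e : R, 0 < e & forall y, enorm (y - x) < e -> P y.
Proof.
split.
  move=> /nbhs_ballP[e /= e0 eP].
  move: e0; rewrite ltcE /= => /andP[/eqP Ie Re0].
  exists (complex.Re e) => // y yx; apply: eP; split=> [|a i]; first by rewrite ltcE /= Ie eqxx.
  rewrite ord1.
  rewrite -ball_normE /= distrC cmodE ltcE /= Ie eqxx/=.
  by apply: le_lt_trans yx; have := cmod_le_enorm (y - x) i; rewrite !mxE.
move=> [e e0 eP]; apply/nbhs_ballP; exists ((e / n.+1%:R)%:C%C) => /=.
  (* n.+1 rather than n, so that the radius makes sense in dimension 0 *)
  by rewrite ltcE /= eqxx divr_gt0.
move=> y [_ yx]; apply: eP; apply: (le_lt_trans (enorm_le_sum (y - x))).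
apply: (@le_lt_trans _ _ (\sum_(i < n) (e / n.+1%:R))).
  apply: ler_sum => i _; have := yx 0 i.
  rewrite -ball_normE /= distrC cmodE ltcE /= => /andP[_ /ltW].
  by rewrite !mxE.
by rewrite sumr_const card_ord -[X in X < _]mulr_natr mulrAC ltr_pdivrMr ?ltr0n//
  ltr_pM2l// ltr_nat.
Qed.

Lemma continuous_sum (R : realType) (T : topologicalType) (I : Type) (r : seq I)
    (f : I -> T -> R) (x : T) :
  (forall i, continuous_at x (f i)) ->
  continuous_at x (fun y => \sum_(i <- r) f i y).
Proof.
move=> cf; elim: r => [|i r IH].
  rewrite (_ : (fun _ => _) = cst 0); first exact: cst_continuous.
  by apply/funext => y; rewrite big_nil.
rewrite (_ : (fun _ => _) = fun y => f i y + \sum_(j <- r) f j y).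
  by apply: cvgD; [exact: cf|exact: IH].
by apply/funext => y; rewrite big_cons.
Qed.

Lemma enorm_continuous (R : realType) n : continuous (@enorm R n).
Proof.
move=> x; apply: (@continuous_comp _ _ _ (fun y : 'CV[R]_n => \sum_(i < n) cmod (y 0 i) ^+ 2)
  (@Num.sqrt R)); last exact: sqrt_continuous.
apply: continuous_sum => i.
apply: (@continuous_comp _ _ _ (fun y : 'CV[R]_n => cmod (y 0 i))
  (fun r : R => r ^+ 2)); last exact: exprn_continuous.
apply: (continuous_comp (@coord_continuous _ _ _ 0 i x)).
exact: cmod_continuous.
Qed.

(** * Integrals of continuous functions on segments *)

Lemma continuous_itv_integrable (R : realType) (f : R -> R) (a b : R) :
  continuous f -> lebesgue_measure.-integrable `[a, b] (EFin \o f).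
Proof.
move=> cf; apply: continuous_compact_integrable; first exact: segment_compact.
exact: continuous_subspaceT.
Qed.

Lemma Rintegral_itv_split (R : realType) (f : R -> R) (a b c : R) :
  continuous f -> a <= b -> b <= c ->
  \int[lebesgue_measure]_(x in `[a, c]) f x =
  \int[lebesgue_measure]_(x in `[a, b]) f x +
  \int[lebesgue_measure]_(x in `[b, c]) f x.
Proof.
move=> cf ab bc.
have iac := @continuous_itv_integrable R f a c cf.
have := Rintegral_itvB iac; move=> /(_ b); rewrite !bnd_simp => /(_ ab bc).
rewrite Rintegral_itv_obnd_cbnd => [<-|]; first by rewrite addrC subrK.
apply: integrableS iac => //; apply: subset_itvr; by rewrite bnd_simp.
Qed.

(** Comparison with a constant is the only estimate on integrals that
    Goursat's lemma and the Riemann sums below require. *)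
Lemma Rintegral_itv_near (R : realType) (f : R -> R) (a b m e : R) :
  continuous f -> a <= b ->
  (forall x, a <= x <= b -> `|f x - m| <= e) ->
  `|\int[lebesgue_measure]_(x in `[a, b]) f x - m * (b - a)| <= e * (b - a).
Proof.
move=> cf ab fm.
have icst r : lebesgue_measure.-integrable `[a, b] (EFin \o (fun=> r : R)).
  by apply: continuous_itv_integrable => x; exact: cst_continuous.
have E (r : R) : \int[lebesgue_measure]_(x in `[a, b]) r = r * (b - a).
  rewrite Rintegral_cst//= lebesgue_measure_itv/= lte_fin; case: ltP => //= ba.
  by rewrite (_ : b = a) ?subrr//; apply/eqP; rewrite eq_le ab ba.
rewrite ler_distl -mulrBl -mulrDl -!E; apply/andP; split;
  apply: le_Rintegral => //; try exact: icst; try exact: continuous_itv_integrable.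
all: move=> x /=; rewrite in_itv/= => /fm; rewrite ler_distl => /andP[? ?] //.
Qed.

Lemma Rintegral_itv_le (R : realType) (f g : R -> R) (a b : R) :
  continuous f -> continuous g -> (forall x, a <= x <= b -> f x <= g x) ->
  \int[lebesgue_measure]_(x in `[a, b]) f x <=
  \int[lebesgue_measure]_(x in `[a, b]) g x.
Proof.
by move=> cf cg fg; apply: le_Rintegral => //; exact: continuous_itv_integrable.
Qed.

(** * Goursat's lemma for closed real forms on rectangles *)

(** Nested intervals. Besides locating the limit of a bisection, it defines the
    limit of a sequence u with |u n.+1 - u n| <= err n - err n.+1 together with
    its error bound, by taking the intervals [u n - err n, u n + err n]. *)
Lemma nested_sup (R : realType) (f g : nat -> R) :
  (forall n, f n <= f n.+1) -> (forall n, g n.+1 <= g n) ->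
  (forall n, f n <= g n) -> forall n, f n <= sup (range f) <= g n.
Proof.
move=> ff gg fg n.
have F : {homo f : i j / (i <= j)%N >-> i <= j} by apply/nondecreasing_seqP.
have G : {homo g : i j / (i <= j)%N >-> j <= i} by apply/nonincreasing_seqP.
have FG i j : f i <= g j.
  by rewrite (le_trans (F _ _ (leq_maxl i j)))// (le_trans (fg _))// G// leq_maxr.
apply/andP; split.
  by apply: ub_le_sup; [exists (g n) => _ [i _ <-]|exists n].
by apply: ge_sup => [|_ [i _ <-]//]; exists (f 0%N), 0%N.
Qed.

(** P and Q have total differentials at (s, t), and the t-derivative of P equals
    the s-derivative of Q (both are C): the form P ds + Q dt is closed at that
    point. *)
Definition cross_differentiable (R : realType) (P Q : R -> R -> R) (s t : R) :=
  exists A B C : R, forall e : R, 0 < e -> exists2 d : R, 0 < d & forall s' t',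
    `|s' - s| < d -> `|t' - t| < d ->
    `|P s' t' - P s t - (A * (s' - s) + C * (t' - t))|
      <= e * (`|s' - s| + `|t' - t|) /\
    `|Q s' t' - Q s t - (C * (s' - s) + B * (t' - t))|
      <= e * (`|s' - s| + `|t' - t|).

Section Goursat.
Context (R : realType) (P Q : R -> R -> R).
Hypothesis cP : forall t, continuous (fun s => P s t).
Hypothesis cQ : forall s, continuous (Q s).

(** The integral of P ds + Q dt around the boundary of [a, b] x [c, e]. *)
Definition loop_integral (a b c e : R) : R :=
  \int[lebesgue_measure]_(s in `[a, b]) (P s c - P s e) +
  \int[lebesgue_measure]_(t in `[c, e]) (Q b t - Q a t).

Let cPB c e : continuous (fun s => P s c - P s e).
Proof. by move=> s; apply: cvgB; exact: cP. Qed.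

Let cQB c e : continuous (fun s => Q c s - Q e s).
Proof. by move=> s; apply: cvgB; exact: cQ. Qed.

Lemma loop_integral_splitl a m b c e : a <= m -> m <= b ->
  loop_integral a b c e = loop_integral a m c e + loop_integral m b c e.
Proof.
move=> am mb; rewrite /loop_integral (@Rintegral_itv_split _ _ a m b)//.
rewrite addrACA; congr (_ + _).
rewrite -RintegralD//; try exact: continuous_itv_integrable.
by apply: eq_Rintegral => t _; ring.
Qed.

Lemma loop_integral_splitr a b c m e : c <= m -> m <= e ->
  loop_integral a b c e = loop_integral a b c m + loop_integral a b m e.
Proof.
move=> am mb; rewrite /loop_integral (@Rintegral_itv_split _ (fun t => Q b t - Q a t) c m e)//.
rewrite addrACA; congr (_ + _).
rewrite -RintegralD//; try exact: continuous_itv_integrable.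
by apply: eq_Rintegral => t _; ring.
Qed.

(** The loop integral is the sum of those over the four quarters of the
    rectangle, so one of them carries at least a fourth of it. *)
Lemma loop_integral_halve a b c e : a <= b -> c <= e -> exists a' b' c' e',
  [/\ a <= a', b' <= b, c <= c' & e' <= e] /\
  [/\ b' - a' = (b - a) / 2, e' - c' = (e - c) / 2 &
      `|loop_integral a b c e| <= 4 * `|loop_integral a' b' c' e'|].
Proof.
move=> ab ce; pose m := (a + b) / 2; pose n := (c + e) / 2.
have [am mb cn ne] : [/\ a <= m, m <= b, c <= n & n <= e].
  by rewrite /m /n; split; lra.
have := loop_integral_splitl c e am mb.
rewrite (loop_integral_splitr a m cn ne) (loop_integral_splitr m b cn ne) => E.
pose big a' b' c' e' := 4 * `|loop_integral a' b' c' e'| < `|loop_integral a b c e|.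
have D a' b' c' e' : [/\ a <= a', b' <= b, c <= c' & e' <= e] ->
   b' - a' = (b - a) / 2 -> e' - c' = (e - c) / 2 ->
   ~ big a' b' c' e' -> exists a' b' c' e',
  [/\ a <= a', b' <= b, c <= c' & e' <= e] /\
  [/\ b' - a' = (b - a) / 2, e' - c' = (e - c) / 2 &
      `|loop_integral a b c e| <= 4 * `|loop_integral a' b' c' e'|].
  move=> ? ? ? /negP; rewrite -leNgt => ?.
  by exists a', b', c', e'; do 2!split => //.
have [b1|] := pselect (big a m c n); last first.
  by apply: D; rewrite /m /n; [split|..]; lra.
have [b2|] := pselect (big a m n e); last first.
  by apply: D; rewrite /m /n; [split|..]; lra.
have [b3|] := pselect (big m b c n); last first.
  by apply: D; rewrite /m /n; [split|..]; lra.
have [b4|] := pselect (big m b n e); last first.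
  by apply: D; rewrite /m /n; [split|..]; lra.
have : `|loop_integral a b c e| <= `|loop_integral a m c n| + `|loop_integral a m n e| +
         (`|loop_integral m b c n| + `|loop_integral m b n e|).
  by rewrite {1}E (le_trans (ler_normD _ _))// lerD// ler_normD.
by move: b1 b2 b3 b4; rewrite /big; lra.
Qed.

(** On a small rectangle the affine parts of P and Q contribute
    C (c - e) (b - a) and C (b - a) (e - c), which cancel; only the remainders
    are left, of order eps times the square of the size. *)
Lemma loop_integral_small s t : cross_differentiable P Q s t ->
  forall eps, 0 < eps -> exists2 d, 0 < d & forall a b c e,
    a <= s <= b -> c <= t <= e -> b - a < d -> e - c < d ->
    `|loop_integral a b c e| <= eps * (b - a + (e - c)) ^+ 2.
Proof.
move=> [A [B [C H]]] eps eps0.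
have [|d d0 {}H] := H (eps / 2); first by rewrite divr_gt0.
exists d => // a b c e asb cte wd hd.
have D x y z w : x <= y <= w -> x <= z <= w -> `|y - z| <= w - x :> R.
  by move=> *; rewrite ler_norml; apply/andP; split; lra.
have {}H s' t' : a <= s' <= b -> c <= t' <= e ->
    `|P s' t' - P s t - (A * (s' - s) + C * (t' - t))|
      <= eps / 2 * (b - a + (e - c)) /\
    `|Q s' t' - Q s t - (C * (s' - s) + B * (t' - t))|
      <= eps / 2 * (b - a + (e - c)).
  move=> hs ht; have [||h1 h2] := H s' t'.
  - by rewrite (le_lt_trans _ wd)// D.
  - by rewrite (le_lt_trans _ hd)// D.
  - by split; [apply: le_trans h1 _|apply: le_trans h2 _];
      rewrite ler_pM2l ?divr_gt0// lerD// D.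
have [ab ce] : a <= b /\ c <= e by lra.
have I1 : `|\int[lebesgue_measure]_(s in `[a, b]) (P s c - P s e) - C * (c - e) * (b - a)|
     <= eps * (b - a + (e - c)) * (b - a).
  apply: Rintegral_itv_near => // x /= xab.
  have [|h1 _] := H x c xab; first by rewrite lexx.
  have [|h2 _] := H x e xab; first by rewrite lexx andbT.
  move: h1 h2; rewrite !ler_norml => /andP[? ?] /andP[? ?].
  by apply/andP; split; lra.
have I2 : `|\int[lebesgue_measure]_(t in `[c, e]) (Q b t - Q a t) - C * (b - a) * (e - c)|
     <= eps * (b - a + (e - c)) * (e - c).
  apply: Rintegral_itv_near => // x /= xab.
  have [|_ h1] := H b x _ xab; first by rewrite lexx andbT.
  have [|_ h2] := H a x _ xab; first by rewrite lexx.
  move: h1 h2; rewrite !ler_norml => /andP[? ?] /andP[? ?].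
  by apply/andP; split; lra.
rewrite /loop_integral; move: I1 I2; rewrite !ler_norml => /andP[? ?] /andP[? ?].
by apply/andP; split; lra.
Qed.

(** Goursat: after n bisections the loop integral is at most 4^n times that over
    a rectangle of size 2^-n, which is at most eps 4^-n times a constant by
    differentiability at the limit point. *)
Lemma loop_integral_eq0 a b c e : a <= b -> c <= e ->
  (forall s t, cross_differentiable P Q s t) -> loop_integral a b c e = 0.
Proof.
move=> ab ce dPQ.
pose lp (r : (R * R) * (R * R)) := loop_integral r.1.1 r.1.2 r.2.1 r.2.2.
pose ok (r : (R * R) * (R * R)) := r.1.1 <= r.1.2 /\ r.2.1 <= r.2.2.
have /choice[step stepP] (r : (R * R) * (R * R)) : exists q, ok r ->
    [/\ r.1.1 <= q.1.1, q.1.2 <= r.1.2, r.2.1 <= q.2.1 & q.2.2 <= r.2.2] /\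
    [/\ q.1.2 - q.1.1 = (r.1.2 - r.1.1) / 2, q.2.2 - q.2.1 = (r.2.2 - r.2.1) / 2 &
        `|lp r| <= 4 * `|lp q|].
  have [[h1 h2]|nok] := pselect (ok r); last by exists r => /nok.
  have [a' [b' [c' [e' [H1 H2]]]]] := loop_integral_halve h1 h2.
  by exists ((a', b'), (c', e')).
pose r n := iter n step ((a, b), (c, e)).
have rok n : ok (r n).
  elim: n => [//|n okn]; have [_ [w h _]] := stepP _ okn; move: okn => [? ?].
  by rewrite /ok -subr_ge0 -[_ <= (r n.+1).2.2]subr_ge0 /r iterS w h; split; lra.
have rw n : (r n).1.2 - (r n).1.1 = (b - a) / 2 ^+ n.
  elim: n => [|n IH]; first by rewrite expr0 divr1.
  have [_ [w _ _]] := stepP _ (rok n).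
  by rewrite /r iterS w IH exprS -mulrA -invfM [2 * _]mulrC.
have rh n : (r n).2.2 - (r n).2.1 = (e - c) / 2 ^+ n.
  elim: n => [|n IH]; first by rewrite expr0 divr1.
  have [_ [_ h _]] := stepP _ (rok n).
  by rewrite /r iterS h IH exprS -mulrA -invfM [2 * _]mulrC.
have rl n : `|loop_integral a b c e| <= 4 ^+ n * `|lp (r n)|.
  elim: n => [|n IH]; first by rewrite expr0 mul1r.
  have [_ [_ _ l]] := stepP _ (rok n).
  by rewrite (le_trans IH)// exprSr -mulrA ler_pM2l ?exprn_gt0.
have := @nested_sup _ (fun n => (r n).1.1) (fun n => (r n).1.2).
set s := sup _ => /(_ _ _ _)/wrap[n|n|n|sP].
- by have [[]] := stepP _ (rok n).
- by have [[]] := stepP _ (rok n).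
- by have [] := rok n.
have := @nested_sup _ (fun n => (r n).2.1) (fun n => (r n).2.2).
set t := sup _ => /(_ _ _ _)/wrap[n|n|n|tP].
- by have [[]] := stepP _ (rok n).
- by have [[]] := stepP _ (rok n).
- by have [] := rok n.
apply/eqP; rewrite -normr_le0; apply/ler_addgt0Pr => eps eps0; rewrite add0r.
(* + 1 because the rectangle may be reduced to a point *)
pose D := (b - a + (e - c)) ^+ 2 + 1.
have D0 : 0 < D by rewrite ltr_wpDl ?sqr_ge0.
have [|d d0 H] := loop_integral_small (dPQ s t) (_ : 0 < eps / D); first by rewrite divr_gt0.
have [n [nw nh]] : exists n, (b - a) / 2 ^+ n < d /\ (e - c) / 2 ^+ n < d.
  have geo (x : R) : x / 2 ^+ n @[n --> \oo] --> (0 : R).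
    under eq_fun do rewrite -exprVn; apply: cvg_geometric.
    by rewrite ger0_norm ?invr_ge0// invf_lt1// ltr1n.
  have := geo (b - a); have := geo (e - c).
  move=> /cvgrPdist_lt/(_ d d0) h1 /cvgrPdist_lt/(_ d d0) h2.
  near \oo => n; exists n; split; near: n.
    apply: filterS h2 => n; rewrite sub0r normrN; apply: le_lt_trans; exact: ler_norm.
  apply: filterS h1 => n; rewrite sub0r normrN; apply: le_lt_trans; exact: ler_norm.
have := H _ _ _ _ (sP n) (tP n); rewrite rw rh => /(_ nw nh) Hn.
rewrite (le_trans (rl n))// (le_trans (ler_wpM2l _ Hn)) ?exprn_ge0//.
rewrite -mulrDl expr_div_n exprAC (_ : 2 ^+ 2 = 4); last by ring.
rewrite [leLHS](_ : _ = eps * ((b - a + (e - c)) ^+ 2 / D)); last first.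
  by field; rewrite expf_neq0// gt_eqF.
by rewrite ler_piMr ?(ltW eps0)// ler_pdivrMr// mul1r lerDl.
Unshelve. all: by end_near.
Qed.

End Goursat.

(** * Complex derivatives and the exponential *)

Lemma cvg_cmodP (R : realType) (h : R[i] -> R[i]) (z l : R[i]) :
  h w @[w --> z^'] --> l <-> forall e : R, 0 < e -> exists2 d : R, 0 < d &
    forall w, cmod (w - z) < d -> w != z -> cmod (h w - l) < e.
Proof.
split=> [hl e e0|hl P /nbhs_cmodP[e e0 eP]].
  have /hl : nbhs l [set y | cmod (y - l) < e] by apply/nbhs_cmodP; exists e.
  by rewrite /= => /nbhs_cmodP[d d0 dP]; exists d.
have [d d0 dP] := hl e e0; apply/nbhs_cmodP; exists d => // w wz wz0.
by apply: eP; exact: dP.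
Qed.

(** Fréchet differentiability over R[i] with real epsilons, the form in which it
    is split into real and imaginary parts. *)
Lemma complex_differentiableP (R : realType) (h : R[i] -> R[i]) (z : R[i]) :
  differentiable h z <-> exists A : R[i], forall e : R, 0 < e ->
    exists2 d : R, 0 < d & forall w, cmod w < d ->
      cmod (h (z + w) - h z - A * w) <= e * cmod w.
Proof.
split.
  move=> /derivable1_diffP /cvg_ex[A] /cvg_cmodP hA; exists A => e e0.
  have [d d0 dP] := hA e e0; exists d => // w wd.
  have [->|w0] := eqVneq w 0.
    by rewrite addr0 subrr mulr0 subr0 cmod0 mulr0.
  have := dP w; rewrite subr0 => /(_ wd w0) /ltW.
  rewrite -(ler_pM2r (_ : 0 < cmod w)) ?cmod_gt0// -cmodM.
  rewrite mulrBl /GRing.scale/= mulr1 mulrAC mulVf// mul1r.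
  by rewrite [w + z]addrC.
move=> [A hA]; apply/derivable1_diffP/cvg_ex; exists A; apply/cvg_cmodP => e e0.
have [|d d0 dP] := hA (e / 2); first by rewrite divr_gt0.
exists d => // w; rewrite subr0 => wd w0; have := dP w wd.
rewrite /GRing.scale/= mulr1 [w + z]addrC => H.
rewrite -(ltr_pM2r (_ : 0 < cmod w)) ?cmod_gt0// -cmodM.
rewrite mulrBl mulrAC mulVf// mul1r (le_lt_trans H)//.
by rewrite ltr_pM2r ?cmod_gt0// ltr_pdivrMr// ltr_pMr// ltr1n.
Qed.

Lemma is_derive_approx (R : realType) (f : R -> R) (x df : R) :
  is_derive x 1 f df -> forall e : R, 0 < e -> exists2 d : R, 0 < d &
    forall h, `|h| < d -> `|f (x + h) - f x - df * h| <= e * `|h|.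
Proof.
move=> [fx <-] e e0.
have /cvgrPdist_lt/(_ e e0) : h^-1 *: (f (h *: 1 + x) - f x) @[h --> 0^'] --> 'D_1 f x.
  exact: fx.
move=> /nbhs_ballP[d /= d0 dP]; exists d => // h hd.
have [->|h0] := eqVneq h 0; first by rewrite addr0 mulr0 !subrr normr0 mulr0.
have := dP h; rewrite /ball/= sub0r normrN => /(_ hd h0) /ltW.
rewrite -(ler_pM2r (_ : 0 < `|h|)) ?normr_gt0// -normrM.
by rewrite mulrBl /GRing.scale/= mulr1 mulrAC mulVf// mul1r distrC [h + x]addrC.
Qed.

Definition cexp (R : realType) (z : R[i]) : R[i] :=
  (expR (complex.Re z))%:C%C * expit (complex.Im z).

Lemma cmod_expit (R : realType) (t : R) : cmod (expit t) = 1.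
Proof. by rewrite /cmod /= cos2Dsin2 sqrtr1. Qed.

Lemma expitD (R : realType) (s t : R) : expit (s + t) = expit s * expit t.
Proof.
by rewrite /expit cosD sinD; apply/eqP; rewrite eq_complex /= eqxx /= addrC.
Qed.

Lemma expit0 (R : realType) : expit (0 : R) = 1.
Proof. by rewrite /expit cos0 sin0. Qed.

Lemma expit2pi (R : realType) : expit (2 * pi : R) = 1.
Proof. by rewrite /expit mulr_natl cos2pi sin2pi. Qed.

Lemma expit_periodic (R : realType) : periodic (@expit R) (2 * pi).
Proof. by move=> t; rewrite expitD expit2pi mulr1. Qed.

Lemma cmod_cexp (R : realType) (z : R[i]) : cmod (cexp z) = expR (complex.Re z).
Proof. by rewrite cmodM cmod_real cmod_expit mulr1 ger0_norm// expR_ge0. Qed.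

Lemma cexpD (R : realType) (z w : R[i]) : cexp (z + w) = cexp z * cexp w.
Proof.
by case: z w => a b [c e]; rewrite /cexp /= expRD expitD rmorphM /= mulrACA.
Qed.

(** The addition formula reduces differentiability to the origin, where
    exp(a) cos b - 1 - a and exp(a) sin b - b are small compared with a + ib by
    the first-order expansions of the real functions. *)
Lemma cexp_differentiable (R : realType) (z : R[i]) : differentiable (@cexp R) z.
Proof.
apply/complex_differentiableP; exists (cexp z) => e e0.
(* the two components below are each at most 3 eta |w| *)
pose eta := Num.min 1 (e / (6 * cmod (cexp z))).
have c0 : 0 < cmod (cexp z) by rewrite cmod_cexp expR_gt0.
have eta0 : 0 < eta by rewrite lt_min ltr01 divr_gt0// mulr_gt0.
have [d1 d10 h1] := is_derive_approx (is_derive_expR (0 : R)) eta0.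
have [d2 d20 h2] := is_derive_approx (is_derive_cos (0 : R)) eta0.
have [d3 d30 h3] := is_derive_approx (is_derive_sin (0 : R)) eta0.
exists (Num.min (Num.min d1 (eta / 2)) (Num.min d2 d3)).
  by rewrite !lt_min d10 d20 d30 divr_gt0.
move=> w; rewrite !lt_min => /andP[/andP[w1 w0] /andP[w2 w3]].
rewrite cexpD (_ : _ - _ = cexp z * (cexp w - 1 - w)); last by ring.
rewrite cmodM; case: w w0 w1 w2 w3 => a b w0 w1 w2 w3.
have A : `|a| <= cmod (a +i* b)%C := Re_le_cmod (a +i* b)%C.
have B : `|b| <= cmod (a +i* b)%C := Im_le_cmod (a +i* b)%C.
have {h1} := h1 a (le_lt_trans A w1).
have {h2} := h2 b (le_lt_trans B w2).
have {h3} := h3 b (le_lt_trans B w3).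
rewrite !add0r expR0 cos0 sin0 !subr0 oppr0 !mul0r !subr0 !mul1r => h3 h2 h1.
have eta1 : eta <= 1 by rewrite ge_min lexx.
have E1 : `|expR a - 1| <= eta.
  have -> : expR a - 1 = (expR a - 1 - a) + a by ring.
  rewrite (le_trans (ler_normD _ _))// (le_trans (lerD h1 (lexx _)))//.
  have : eta * `|a| <= `|a| by rewrite ler_piMl.
  by move: A w0; set r := cmod _; lra.
have E2 : 0 <= expR a <= 2.
  by rewrite expR_ge0 /=; move: E1; rewrite ler_norml => /andP[_]; lra.
have H1 : `|expR a * cos b - 1 - a| <= 3 * eta * cmod (a +i* b)%C.
  have -> : expR a * cos b - 1 - a = expR a * (cos b - 1) + (expR a - 1 - a) by ring.
  rewrite (le_trans (ler_normD _ _))// (le_trans (lerD (lexx _) h1))// normrM.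
  rewrite (_ : 3 * _ * _ = 2 * (eta * cmod (a +i* b)%C) + eta * cmod (a +i* b)%C); last by ring.
  rewrite lerD// ?ler_pM2l// ler_pM//; first by rewrite ger0_norm; lra.
  by rewrite (le_trans h2)// ler_pM2l.
have H2 : `|expR a * sin b - b| <= 3 * eta * cmod (a +i* b)%C.
  have -> : expR a * sin b - b = expR a * (sin b - b) + (expR a - 1) * b by ring.
  rewrite (le_trans (ler_normD _ _))// !normrM.
  rewrite (_ : 3 * _ * _ = 2 * (eta * cmod (a +i* b)%C) + eta * cmod (a +i* b)%C); last by ring.
  rewrite lerD// ler_pM//; first by rewrite ger0_norm; lra.
  by rewrite (le_trans h3)// ler_pM2l.
have -> : cexp (a +i* b)%C - 1 - (a +i* b)%C =
    ((expR a * cos b - 1 - a) +i* (expR a * sin b - b))%C.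
  by rewrite /cexp /expit; simpc.
rewrite (le_trans (ler_wpM2l _ (cmod_le _ _))) ?cmod_ge0//.
rewrite (le_trans (ler_wpM2l _ (lerD H1 H2))) ?cmod_ge0//.
rewrite (_ : _ * (_ + _) = eta * (6 * cmod (cexp z)) * cmod (a +i* b)%C); last by ring.
rewrite ler_wpM2r ?cmod_ge0// -ler_pdivlMr ?mulr_gt0//.
by rewrite ge_min lexx orbT.
Qed.

(** * Mean value property and maximum principle *)

(** The form is the imaginary part of g dz; that it is closed is one of the
    Cauchy-Riemann equations. *)
Lemma cross_differentiable_complex (R : realType) (g : R[i] -> R[i]) (s t : R) :
  differentiable g (s +i* t)%C ->
  cross_differentiable (fun s t => complex.Im (g (s +i* t)%C))
    (fun s t => complex.Re (g (s +i* t)%C)) s t.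
Proof.
move=> /complex_differentiableP[[al be] gA]; exists be, (- be), al => e e0.
have [d d0 dP] := gA e e0; exists (d / 2); first by rewrite divr_gt0.
move=> s' t' s's t't.
have cl : cmod ((s' - s) +i* (t' - t))%C <= `|s' - s| + `|t' - t| := cmod_le _ _.
have := dP ((s' - s) +i* (t' - t))%C; rewrite (le_lt_trans cl) => [/(_ isT)|]; last by lra.
have -> : (s +i* t)%C + ((s' - s) +i* (t' - t))%C = (s' +i* t')%C.
  by apply/eqP; rewrite eq_complex /= !subrKC !eqxx.
set w := (g _ - g _ - _) => H.
have {}H : cmod w <= e * (`|s' - s| + `|t' - t|).
  by rewrite (le_trans H)// ler_pM2l.
have le_of_eq (x y : R) : x = y -> x <= y by move=> ->.
split; apply: le_trans H; [have := Im_le_cmod w|have := Re_le_cmod w];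
  apply: le_trans; rewrite /w; case: (g _) => a b; case: (g _) => a' b' /=;
  apply: le_of_eq; congr `|_|; ring.
Qed.

(** Working with h(e^(s+it)) instead of h turns the annulus between two circles
    into a rectangle, on which Goursat's lemma gives the mean value property
    directly, without primitives. *)
Section MaximumPrinciple.
Context (R : realType) (H : R[i] -> R[i]).
Hypothesis dH : forall z, differentiable H z.

Let cH : continuous H.
Proof. by move=> z; exact: differentiable_continuous. Qed.

Let Q (s t : R) := complex.Re (H (cexp (s +i* t)%C)).
Let P (s t : R) := complex.Im (H (cexp (s +i* t)%C)).

Let cQs s : continuous (Q s).
Proof.
move=> t; apply: (@continuous_comp _ _ _ (fun t => (s +i* t)%C : R[i])
   (fun z : R[i] => complex.Re (H (cexp z)))).
  by apply: complex_continuous; [exact: cst_continuous|exact: cvg_id].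
apply: (@continuous_comp _ _ _ (fun z : R[i] => H (cexp z)) (@complex.Re R));
  last exact: Re_continuous.
apply: (@continuous_comp _ _ _ (@cexp R) H); last exact: cH.
exact/differentiable_continuous/cexp_differentiable.
Qed.

Let cPt t : continuous (fun s => P s t).
Proof.
move=> s; apply: (@continuous_comp _ _ _ (fun s => (s +i* t)%C : R[i])
   (fun z : R[i] => complex.Im (H (cexp z)))).
  by apply: complex_continuous; [exact: cvg_id|exact: cst_continuous].
apply: (@continuous_comp _ _ _ (fun z : R[i] => H (cexp z)) (@complex.Im R));
  last exact: Im_continuous.
apply: (@continuous_comp _ _ _ (@cexp R) H); last exact: cH.
exact/differentiable_continuous/cexp_differentiable.
Qed.

(** The two sides t = 0 and t = 2 pi of the rectangle cancel by periodicity. *)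
Lemma mean_Re_radius (s0 s1 : R) : s0 <= s1 ->
  \int[lebesgue_measure]_(t in `[0, 2 * pi]) Q s0 t =
  \int[lebesgue_measure]_(t in `[0, 2 * pi]) Q s1 t.
Proof.
move=> s01.
have : loop_integral P Q s0 s1 0 (2 * pi) = 0.
  apply: loop_integral_eq0 => // [|s t]; first by rewrite mulr_ge0// pi_ge0.
  apply: (@cross_differentiable_complex _ (H \o @cexp R)).
  by apply: differentiable_comp; [exact: cexp_differentiable|exact: dH].
rewrite /loop_integral; have P0 s : P s 0 - P s (2 * pi) = 0.
  by rewrite /P /cexp /= expit2pi expit0 subrr.
under eq_Rintegral do rewrite P0.
rewrite Rintegral_cst// mul0r add0r RintegralB//; try exact: continuous_itv_integrable.
by move=> /eqP; rewrite subr_eq0 => /eqP ->.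
Qed.

Lemma mean_Re : \int[lebesgue_measure]_(t in `[0, 2 * pi]) complex.Re (H (expit t)) =
  complex.Re (H 0) * (2 * pi).
Proof.
have pi0 : 0 < 2 * pi :> R by rewrite mulr_gt0// pi_gt0.
have Q0 t : Q 0 t = complex.Re (H (expit t)).
  by rewrite /Q /cexp /= expR0 mul1r.
under eq_Rintegral do rewrite -Q0.
apply/eqP; rewrite -subr_eq0 -normr_le0; apply/ler_addgt0Pr => e e0; rewrite add0r.
have /(_ (H 0)) := @Re_continuous R; move=> /(continuous_comp (cH (x:=0))).
move=> /cvgrPdist_lt/(_ (e / (2 * pi))).
rewrite divr_gt0// => /(_ isT) /nbhs_cmodP[d d0 dP].
(* the circle of radius e^s lies in the d-ball where Re h is close to Re h(0) *)
pose s := ln (Num.min 1 (d / 2)).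
have m0 : 0 < Num.min 1 (d / 2) by rewrite lt_min ltr01 divr_gt0.
have s0 : s <= 0 by rewrite ln_le0// ge_min lexx.
rewrite -(mean_Re_radius s0).
have := @Rintegral_itv_near _ (Q s) 0 (2 * pi) (complex.Re (H 0)) (e / (2 * pi)) (@cQs s) (ltW pi0).
rewrite subr0 divfK ?gt_eqF//; apply => t _.
rewrite distrC ltW//; apply: dP; rewrite subr0 cmod_cexp /= lnK//.
by rewrite (@le_lt_trans _ _ (d / 2)) ?ge_min ?lexx ?orbT// ltr_pdivrMr// ltr_pMr// ltr1n.
Qed.

Lemma Re_le_circle (B : R) : (forall t, 0 <= t -> complex.Re (H (expit t)) <= B) ->
  complex.Re (H 0) <= B.
Proof.
have pi0 : 0 < 2 * pi :> R by rewrite mulr_gt0// pi_gt0.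
move=> HB; rewrite -(ler_pM2r pi0) -mean_Re.
have Q0 t : Q 0 t = complex.Re (H (expit t)) by rewrite /Q /cexp /= expR0 mul1r.
under eq_Rintegral do rewrite -Q0.
have -> : B * (2 * pi) = \int[lebesgue_measure]_(t in `[0, 2 * pi]) B.
  by rewrite Rintegral_cst//= lebesgue_measure_itv/= lte_fin pi0/= subr0.
apply: Rintegral_itv_le => // [x|x /andP[x0 _]]; first exact: cst_continuous.
by rewrite Q0 HB.
Qed.

End MaximumPrinciple.

(** Multiplying by the conjugate of the value at 0 makes that value real, which
    reduces the claim to real parts. *)
Lemma cmod_le_circle (R : realType) (H : R[i] -> R[i]) (B : R) :
  (forall z, differentiable H z) -> (forall t, 0 <= t -> cmod (H (expit t)) <= B) ->
  cmod (H 0) <= B.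
Proof.
move=> dH HB; have B0 : 0 <= B := le_trans (cmod_ge0 _) (HB 0 (lexx 0)).
have [->|H0] := eqVneq (H 0) 0; first by rewrite cmod0.
have c0 : 0 < cmod (H 0) by rewrite cmod_gt0.
have cJ (z : R[i]) : cmod z^*%C = cmod z.
  by case: z => a b; rewrite /cmod /= sqrrN.
have := @Re_le_circle _ (fun z => (H 0)^*%C * H z) _ (cmod (H 0) * B).
have -> : complex.Re ((H 0)^*%C * H 0) = cmod (H 0) * cmod (H 0).
  rewrite -expr2; case: (H 0) => a b; rewrite /cmod /= sqr_sqrtr ?addr_ge0 ?sqr_ge0//.
  by rewrite mulNr opprK -!expr2.
rewrite ler_pM2l//; apply.
  by move=> z; apply: differentiableM; [exact: differentiable_cst|exact: dH].
move=> t t0; rewrite (le_trans (ler_norm _))// (le_trans (Re_le_cmod _))// cmodM cJ.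
by rewrite ler_pM2l// HB.
Qed.

(** * Subharmonicity of log|h|: circular majorants *)

Lemma itv_unif_continuous (R : realType) (f : R -> R) (a b e : R) :
  continuous f -> 0 < e -> exists2 d : R, 0 < d &
    forall x y, a <= x <= b -> `|x - y| < d -> `|f x - f y| < e.
Proof.
move=> cf e0; have e20 : 0 < e / 2 by rewrite divr_gt0.
have /compact_near_coveringP cpt := @segment_compact R a b.
have := cpt R (0^'+) (fun d x => forall y, `|x - y| < d -> `|f x - f y| < e) _.
case=> [x0 _|d /= d0 dP].
  have /cvgrPdist_lt/(_ _ e20)/nbhs_ballP[r /= r0 rP] := cf x0.
  exists (ball x0 (r / 2), [set d | d < r / 2]) => /=.
    split; first by apply: nbhsx_ballx; rewrite divr_gt0.
    by apply: nbhs_right_lt; rewrite divr_gt0.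
  move=> [x d] /= [x0x dr] y xy.
  have h1 : `|f x0 - f x| < e / 2.
    by apply: rP; rewrite /ball /= (lt_trans x0x)// ltr_pdivrMr// ltr_pMr// ltr1n.
  have h2 : `|f x0 - f y| < e / 2.
    apply: rP; rewrite /ball /= (_ : x0 - y = (x0 - x) + (x - y)); last by ring.
    rewrite (le_lt_trans (ler_normD _ _))//; move: x0x; rewrite /ball/=; lra.
  rewrite (_ : f x - f y = - (f x0 - f x) + (f x0 - f y)); last by ring.
  by rewrite (le_lt_trans (ler_normD _ _))// normrN; lra.
exists (d / 2); first by rewrite divr_gt0.
have /(_ _ _)/wrap[||K] := dP (d / 2).
- by rewrite /= sub0r normrN ger0_norm ?divr_ge0 ?ltW// ltr_pdivrMr// ltr_pMr// ltr1n.
- by rewrite divr_gt0.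
by move=> x y xab; apply: K; rewrite /= in_itv.
Qed.

Lemma sum_periodic (R : realType) (N : nat) (f : nat -> R) (m : nat) :
  (forall j, f (j + N)%N = f j) ->
  \sum_(j < N) f (j + m)%N = \sum_(j < N) f j.
Proof.
move=> fN; elim: m => [|m IH]; first by under eq_bigr do rewrite addn0.
rewrite -IH; case: N fN {IH} => [|N] fN; first by rewrite !big_ord0.
rewrite big_ord_recr/= [RHS]big_ord_recl/= addrC.
congr (_ + _); first by rewrite addnS -addSn addnC fN.
by apply: eq_bigr => j _; rewrite /bump /= add1n addSnnS.
Qed.

Section Riemann.
Context (R : realType) (Phi : R -> R).
Hypotheses (cPhi : continuous Phi) (pPhi : periodic Phi (2 * pi)).

Let tau : R := 2 * pi.
Let tau0 : 0 < tau. Proof. by rewrite mulr_gt0// pi_gt0. Qed.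

(** Uniformity in the shift t is what matters. By periodicity of Phi and
    cyclicity of the sum, t can be reduced modulo the step tau / N, and then the
    nodes fall one by one in the N cells of the subdivision. *)
Lemma riemann_sum_le (e : R) : 0 < e -> exists2 N, (0 < N)%N & forall t, 0 <= t ->
  \sum_(j < N) Phi (t + tau * j%:R / N%:R) <=
  N%:R * (tau^-1 * \int[lebesgue_measure]_(t in `[0, tau]) Phi t + e).
Proof.
move=> e0; have [d d0 dP] := itv_unif_continuous 0 tau cPhi e0.
pose N := (Num.truncn (tau / d)).+1.
have N0 : 0 < N%:R :> R by rewrite ltr0n.
have hd : tau / N%:R < d.
  rewrite ltr_pdivrMr// mulrC -ltr_pdivrMr// /N.
  by apply: truncnS_gt.
exists N => // t t0.
pose h := tau / N%:R; have h0 : 0 < h by rewrite divr_gt0.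
have node s j : s + tau * j%:R / N%:R = s + h * j%:R by rewrite mulrAC.
under eq_bigr do rewrite node.
pose m := Num.truncn (t / h); pose s := t - h * m%:R.
have [s0 sh] : 0 <= s /\ s < h.
  have := truncn_itv (divr_ge0 t0 (ltW h0)); rewrite -/m => /andP[].
  by rewrite ler_pdivlMr// ltr_pdivrMr// -natr1 /s => ? ?; split; lra.
have -> : \sum_(j < N) Phi (t + h * j%:R) = \sum_(j < N) Phi (s + h * j%:R).
  rewrite -(@sum_periodic _ N (fun j => Phi (s + h * j%:R)) m).
    by apply: eq_bigr => j _; congr Phi; rewrite /s natrD; ring.
  move=> j; rewrite natrD mulrDr addrA.
  by rewrite /h [_ / _ * N%:R]divfK ?gt_eqF// pPhi.
have cell n : (n <= N)%N -> h * \sum_(j < n) (Phi (s + h * j%:R) - e) <=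
    \int[lebesgue_measure]_(t in `[0, h * n%:R]) Phi t.
  elim: n => [|n IH] nN.
    by rewrite big_ord0 !mulr0 set_itv1 Rintegral_set1.
  have hn : h * n%:R <= h * n.+1%:R by rewrite ler_pM2l// ler_nat.
  have a0 : 0 <= h * n%:R by rewrite mulr_ge0// ltW.
  rewrite (@Rintegral_itv_split _ _ 0 (h * n%:R))//.
  rewrite big_ord_recr/= mulrDr.
  rewrite lerD//; first by apply: IH; exact: ltnW.
  have /(_ _)/wrap := @Rintegral_itv_near _ Phi (h * n%:R) (h * n.+1%:R)
    (Phi (s + h * n%:R)) e cPhi hn.
  rewrite -mulrBr -natrB// subSnn mulr1 => -[x /andP[x1 x2]|].
    rewrite -natr1 in x2; apply/ltW/dP.
      have : h * n.+1%:R <= tau.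
        by rewrite /h mulrAC ler_pdivrMr// ler_pM2l// ler_nat.
      rewrite -natr1; have : 0 <= h * n%:R by rewrite mulr_ge0// ltW.
      by move=> *; apply/andP; split; lra.
    by apply: le_lt_trans hd; rewrite -/h ler_norml; apply/andP; split; lra.
  by rewrite ler_norml => /andP[+ _]; rewrite mulrC; lra.
have := cell N (leqnn N); rewrite {2}/h divfK ?gt_eqF//.
rewrite sumrB sumr_const card_ord -[e *+ N]mulr_natl.
set S := \sum_(j < N) _; set I := Rintegral _ _ _ => H.
rewrite mulrDr -lerBlDr -(ler_pM2l h0) (le_trans H)//.
by rewrite /h [leRHS](_ : _ = I)//; field; rewrite !gt_eqF.
Qed.

End Riemann.

Lemma differentiable_prod (R : realType) (I : Type) (r : seq I)
    (f : I -> R[i] -> R[i]) (z : R[i]) :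
  (forall i, differentiable (f i) z) ->
  differentiable (fun w => \prod_(i <- r) f i w) z.
Proof.
move=> df; elim: r => [|i r IH].
  rewrite (_ : (fun _ => _) = cst 1); first exact: differentiable_cst.
  by apply/funext => y; rewrite big_nil.
rewrite (_ : (fun _ => _) = fun w => f i w * \prod_(j <- r) f j w).
  by apply: differentiableM; [exact: df|exact: IH].
by apply/funext => y; rewrite big_cons.
Qed.

(** The submean inequality for log|h|, tested on continuous majorants. The
    maximum principle for the product of the h(w^j z) bounds |h(0)|^N by the
    exponential of N times a Riemann sum of Phi. *)
Lemma le_exp_mean (R : realType) (h : R[i] -> R[i]) (Phi : R -> R) :
  (forall z, differentiable h z) -> continuous Phi -> periodic Phi (2 * pi) ->
  (forall t, cmod (h (expit t)) <= expR (Phi t)) ->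
  cmod (h 0) <=
    expR ((2 * pi)^-1 * \int[lebesgue_measure]_(t in `[0, 2 * pi]) Phi t).
Proof.
move=> dh cPhi pPhi hPhi; set mu := _^-1 * _.
have [->|h0] := eqVneq (h 0) 0; first by rewrite cmod0 expR_ge0.
have c0 : 0 < cmod (h 0) by rewrite cmod_gt0.
rewrite -ler_ln ?posrE ?expR_gt0// expRK; apply/ler_addgt0Pr => e e0.
have [N N0 NP] := riemann_sum_le cPhi pPhi e0.
pose H z := \prod_(j < N) h (expit (2 * pi * j%:R / N%:R) * z).
have H0 : H 0 = h 0 ^+ N.
  by rewrite /H; under eq_bigr do rewrite mulr0; rewrite prodr_const card_ord.
have : cmod (H 0) <= expR (N%:R * (mu + e)).
  apply: cmod_le_circle => [z|t t0].
    apply: differentiable_prod => j.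
    apply: (@differentiable_comp _ _ _ _ (fun z => expit (2 * pi * j%:R / N%:R) * z) h) => //.
  rewrite (le_trans _ (_ : expR (\sum_(j < N) Phi (t + 2 * pi * j%:R / N%:R)) <= _))//.
    rewrite expR_sum cmod_prod ler_prod// => j _; rewrite cmod_ge0/= -expitD addrC.
    exact: hPhi.
  by rewrite ler_expR NP.
rewrite H0 expRM_natl.
rewrite cmodX ler_pXn2r ?nnegrE ?cmod_ge0 ?expR_ge0// => HH.
by rewrite -ler_expR lnK.
Qed.

(** * Vector-valued holomorphic maps *)

(** Cauchy-Schwarz, from a b <= (B/A a^2 + A/B b^2) / 2 where A and B are the
    norms of the two vectors. *)
Lemma sum_mul_le_sqrt (R : realType) n (a b : 'I_n -> R) :
  \sum_i a i * b i <= Num.sqrt (\sum_i a i ^+ 2) * Num.sqrt (\sum_i b i ^+ 2).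
Proof.
have A0 : 0 <= \sum_i a i ^+ 2 by apply: sumr_ge0 => i _; exact: sqr_ge0.
have B0 : 0 <= \sum_i b i ^+ 2 by apply: sumr_ge0 => i _; exact: sqr_ge0.
set A := Num.sqrt (\sum_i a i ^+ 2); set B := Num.sqrt (\sum_i b i ^+ 2).
have AE : \sum_i a i ^+ 2 = A ^+ 2 by rewrite sqr_sqrtr.
have BE : \sum_i b i ^+ 2 = B ^+ 2 by rewrite sqr_sqrtr.
have z (c : 'I_n -> R) : \sum_i c i ^+ 2 = 0 -> forall i, c i = 0.
  move=> /eqP; rewrite psumr_eq0 => [/allP c0 i|i _]; last exact: sqr_ge0.
  by have := c0 i; rewrite mem_index_enum sqrf_eq0 => /(_ isT)/eqP.
have [A00|An0] := eqVneq A 0.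
  rewrite A00 mul0r big1// => i _; rewrite z ?mul0r//.
  by rewrite AE A00 expr0n.
have [B00|Bn0] := eqVneq B 0.
  rewrite B00 mulr0 big1// => i _; rewrite [b i]z ?mulr0//.
  by rewrite BE B00 expr0n.
have [Ap Bp] : 0 < A /\ 0 < B by rewrite !lt_neqAle ![0 == _]eq_sym An0 Bn0 !sqrtr_ge0.
have -> : A * B = \sum_i (B / A * a i ^+ 2 + A / B * b i ^+ 2) / 2.
  rewrite -mulr_suml big_split/= -!mulr_sumr AE BE; field.
  by rewrite An0 Bn0.
apply: ler_sum => i _; rewrite ler_pdivlMr//.
rewrite -subr_ge0 (_ : _ - _ = (B * a i - A * b i) ^+ 2 / (A * B)); last first.
  by field; rewrite An0 Bn0.
by rewrite divr_ge0 ?sqr_ge0// mulr_ge0// ltW.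
Qed.

Lemma cmod_herm_le (R : realType) n (v y : 'CV[R]_n) :
  cmod (\sum_i (v 0 i)^*%C * y 0 i) <= enorm v * enorm y.
Proof.
rewrite (le_trans (cmod_sum _ _))//; under eq_bigr do rewrite cmodM cmodJ.
exact: sum_mul_le_sqrt.
Qed.

Lemma herm_enorm (R : realType) n (v : 'CV[R]_n) :
  \sum_i (v 0 i)^*%C * v 0 i = ((enorm v ^+ 2)%:C)%C.
Proof.
rewrite sqr_sqrtr ?sumr_ge0// => [|i _]; last exact: sqr_ge0.
rewrite rmorph_sum/=; apply: eq_bigr => i _.
case: (v 0 i) => a b; rewrite /cmod /= sqr_sqrtr ?addr_ge0 ?sqr_ge0//.
by simpc; rewrite -!expr2 mulrC subrr.
Qed.

(** Pairing with the unit vector v = h(0) / ||h(0)|| produces a scalar function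
    whose modulus is at most ||h||, with equality at 0. *)
Lemma enorm_le_exp_mean (R : realType) n (h : R[i] -> 'CV[R]_n) (Phi : R -> R) :
  (forall z, differentiable h z) -> continuous Phi -> periodic Phi (2 * pi) ->
  (forall t, enorm (h (expit t)) <= expR (Phi t)) ->
  enorm (h 0) <=
    expR ((2 * pi)^-1 * \int[lebesgue_measure]_(t in `[0, 2 * pi]) Phi t).
Proof.
move=> dh cPhi pPhi hPhi; have [->|h0] := eqVneq (h 0) 0.
  by rewrite enorm0 expR_ge0.
have e0 : 0 < enorm (h 0) by rewrite enorm_gt0.
have [v v1 hE] : exists2 v, enorm v = 1 & h 0 = (enorm (h 0))%:C%C *: v.
  exists (((enorm (h 0))^-1)%:C%C *: h 0).
    by rewrite enormZ cmod_real ger0_norm ?invr_ge0 ?ltW// mulVf// gt_eqF.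
  by rewrite scalerA -rmorphM/= mulfV ?gt_eqF// scale1r.
pose H z := \sum_i (v 0 i)^*%C * h z 0 i.
have <- : cmod (H 0) = enorm (h 0).
  have hEi i : h 0 0 i = (enorm (h 0))%:C%C * v 0 i by rewrite {1}hE mxE.
  rewrite /H; under eq_bigr do rewrite hEi mulrCA.
  by rewrite -mulr_sumr herm_enorm v1 expr1n mulr1 cmod_real ger0_norm// ltW.
apply: le_exp_mean => // [z|t]; last first.
  by rewrite (le_trans (cmod_herm_le _ _))// v1 mul1r.
have -> : H = \sum_i (fun z => (v 0 i)^*%C * h z 0 i).
  by apply/funext => y; rewrite fct_sumE.
apply: differentiable_sum => i; apply: differentiableM.
  exact: differentiable_cst.
apply: (@differentiable_comp _ _ _ _ h (fun y : 'CV[R]_n => y 0 i)) => //.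
exact: differentiable_coord.
Qed.

Lemma enorm_line_le_exp_mean (R : realType) m n (H : 'CV[R]_m -> 'CV[R]_n) z w
    (Phi : R -> R) :
  holomorphic H -> continuous Phi -> periodic Phi (2 * pi) ->
  (forall t, enorm (H (z + expit t *: w)) <= expR (Phi t)) ->
  enorm (H z) <=
    expR ((2 * pi)^-1 * \int[lebesgue_measure]_(t in `[0, 2 * pi]) Phi t).
Proof.
move=> dH cPhi pPhi HPhi.
have -> : H z = (H \o (fun c : R[i] => z + c *: w)) 0 by rewrite /= scale0r addr0.
apply: enorm_le_exp_mean => // c; apply: differentiable_comp; last exact: dH.
apply: differentiableD; first exact: differentiable_cst.
exact: differentiableZl.
Qed.

(** * Compactness of the sphere and the uniform growth bound *)

(** The sphere is a closed subset of a product of squares of C. *)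
Lemma compact_unit_sphere (R : realType) n :
  compact [set x : 'CV[R]_n | enorm x = 1].
Proof.
pose D : set R[i] := (fun q : R * R => (q.1 +i* q.2)%C) @` (`[-1, 1] `*` `[-1, 1]).
have cD : compact D.
  apply: continuous_compact; last by apply: compact_setX; exact: segment_compact.
  apply: continuous_subspaceT => q; apply: complex_continuous.
    exact: cvg_fst.
  exact: cvg_snd.
apply: (@subclosed_compact _ _ [set x : 'CV[R]_n | forall i, D (x ord0 i)]).
- rewrite (_ : [set _ | _] = @enorm R n @^-1` [set r | r = 1])//.
  by apply: preimage_closed; [move=> x _; exact: enorm_continuous|exact: closed_eq].
- exact: (@rV_compact R[i] n (fun=> D)).
- move=> x /= x1 i; have := cmod_le_enorm x i; rewrite x1.
  have := Re_le_cmod (x 0 i); have := Im_le_cmod (x 0 i).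
  case: (x 0 i) => a b /= h1 h2 h3; exists (a, b) => //=; split => /=.
    by rewrite in_itv/= -ler_norml (le_trans h2).
  by rewrite in_itv/= -ler_norml (le_trans h1).
Qed.

Lemma compact_continuous_bounded (R : realType) (T : topologicalType)
    (K : set T) (u : T -> R) :
  compact K -> (forall x, K x -> continuous_at x u) ->
  exists2 C, 0 <= C & forall x, K x -> `|u x| <= C.
Proof.
move=> /compact_near_coveringP cK cu.
have h : \forall C \near (+oo%R : set_system R), K `<=` (fun x => `|u x| <= C).
  apply: (cK R (+oo%R : set_system R) (fun C x => `|u x| <= C)) => x Kx.
  exists ([set y | `|u x - u y| < 1], [set C | `|u x| + 1 <= C]) => /=.
    split; last exact: nbhs_pinfty_ge.
    by have /cvgrPdist_lt/(_ 1 ltr01) := cu x Kx.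
  move=> [y C] /= [h1 h2]; rewrite (le_trans _ h2)//.
  rewrite -[u y](subrK (u x)) addrC (le_trans (ler_normD _ _))// lerD2l distrC.
  exact: ltW.
near (+oo%R : set_system R) => C; exists C; first by near: C; exact: nbhs_pinfty_ge.
by near: C.
Unshelve. all: by end_near.
Qed.

Lemma geometric_small (R : realType) (d : nat) (K e : R) : (2 <= d)%N -> 0 < e ->
  exists n, forall m, (n <= m)%N -> K / d%:R ^+ m < e.
Proof.
move=> d2 e0.
have geo : K / d%:R ^+ n @[n --> \oo] --> (0 : R).
  under eq_fun do rewrite -exprVn; apply: cvg_geometric.
  by rewrite ger0_norm ?invr_ge0// invf_lt1 ?ltr1n// ltr0n (leq_trans _ d2).
move/cvgrPdist_lt : geo => /(_ e e0)[n _ nP]; exists n => m nm.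
by have := nP m nm; rewrite /= sub0r normrN; apply: le_lt_trans; exact: ler_norm.
Qed.

(** * The Green function of a nonautonomous family *)

Section Green.
Context (R : realType) (M : topologicalType) (sigma : M -> M) (k d : nat).
Context (F : M -> 'CV[R]_k.+1 -> 'CV[R]_k.+1).
Hypotheses (sigmaC : continuous sigma) (d_ge2 : (2 <= d)%N).
Hypothesis Fhom : forall l, homogeneous_map d (F l).
Hypothesis Fnz : forall l, Defs.nondegenerate (F l).
Hypothesis FC : continuous (fun q : M * 'CV[R]_k.+1 => F q.1 q.2).

Local Notation Fn := (fiber_iter sigma F).

Lemma lift_eq0 (l : M) (x : 'CV[R]_k.+1) : (F l x == 0) = (x == 0).
Proof.
have E := Fnz l; have : (F l @^-1` [set 0]) x <-> [set 0] x by rewrite E.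
by move=> /= [h1 h2]; apply/eqP/eqP.
Qed.

(** The left-hand side is invariant under scaling of x, hence a continuous
    function of the parameter and of the direction. *)
Lemma ln_lift_bound : compact [set: M] -> exists2 C, 0 <= C &
  forall (l : M) (x : 'CV[R]_k.+1), x != 0 ->
    `|ln (enorm (F l x)) - d%:R * ln (enorm x)| <= C.
Proof.
move=> cM; pose u (q : M * 'CV[R]_k.+1) := ln (enorm (F q.1 q.2)).
have cK : compact ([set: M] `*` [set x : 'CV[R]_k.+1 | enorm x = 1]).
  by apply: compact_setX => //; exact: compact_unit_sphere.
have [|C C0 CP] := @compact_continuous_bounded _ _ _ u cK.
  move=> [l x] [_ /= x1]; rewrite /u.
  apply: (@continuous_comp _ _ _ (fun q : M * 'CV[R]_k.+1 => F q.1 q.2)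
    (fun y => ln (enorm y))); first exact: FC.
  apply: (@continuous_comp _ _ _ (@enorm R k.+1) (@ln R)).
    exact: enorm_continuous.
  by apply: continuous_ln; rewrite enorm_gt0 /= lift_eq0 -enorm_gt0 x1.
exists C => // l x x0; have e0 : 0 < enorm x by rewrite enorm_gt0.
pose y := ((enorm x)^-1)%:C%C *: x.
have y1 : enorm y = 1.
  by rewrite enormZ cmod_real ger0_norm ?invr_ge0 ?ltW// mulVf// gt_eqF.
have := CP (l, y); rewrite /u/= => /(_ (conj I y1)).
rewrite /y Fhom enormZ cmodX cmod_real.
have i0 : 0 < (enorm x)^-1 by rewrite invr_gt0.
rewrite (ger0_norm (ltW i0)) lnM ?posrE ?exprn_gt0 ?invr_gt0 ?enorm_gt0 ?lift_eq0//.
by rewrite lnXn ?invr_gt0// lnV// mulNrn addrC mulr_natl.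
Qed.

Lemma fiber_iterS n (l : M) (x : 'CV[R]_k.+1) : Fn n.+1 l x = Fn n (sigma l) (F l x).
Proof. by elim: n => [//|n IH]; rewrite /= -IH/= -iterSr. Qed.

Lemma fiber_iter_eq0 n (l : M) (x : 'CV[R]_k.+1) : (Fn n l x == 0) = (x == 0).
Proof. by elim: n => [//|n IH]; rewrite /= lift_eq0. Qed.

Lemma fiber_iterZ n (l : M) (c : R[i]) (x : 'CV[R]_k.+1) :
  Fn n l (c *: x) = c ^+ (d ^ n) *: Fn n l x.
Proof.
elim: n => [|n IH]; first by rewrite expn0 expr1.
by rewrite /= IH Fhom -exprM expnSr.
Qed.

Lemma fiber_iter_continuous n : continuous (fun q : M * 'CV[R]_k.+1 => Fn n q.1 q.2).
Proof.
have cs m : continuous (iter m sigma).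
  by elim: m => [|m IH] x; [exact: cvg_id|apply: continuous_comp; [exact: IH|exact: sigmaC]].
elim: n => [|n IH] q; first exact: cvg_snd.
apply: (@continuous_comp _ _ _ (fun q : M * 'CV[R]_k.+1 => (iter n sigma q.1, Fn n q.1 q.2))
  (fun q => F q.1 q.2)); last exact: FC.
apply: (@cvg_pair _ _ _ (nbhs q) (nbhs (iter n sigma q.1)) (nbhs (Fn n q.1 q.2)));
  last exact: IH.
apply: (@continuous_comp _ _ _ fst (iter n sigma)); [exact: cvg_fst|exact: cs].
Qed.

(** The function G_(n,l) off the origin, as a real number. *)
Definition log_iter n (l : M) (x : 'CV[R]_k.+1) : R :=
  (d%:R ^+ n)^-1 * ln (enorm (Fn n l x)).

Context (C : R).
Hypothesis C0 : 0 <= C.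
Hypothesis CP : forall (l : M) (x : 'CV[R]_k.+1), x != 0 ->
  `|ln (enorm (F l x)) - d%:R * ln (enorm x)| <= C.

Let d0 : 0 < d%:R :> R. Proof. by rewrite ltr0n (leq_trans _ d_ge2). Qed.

Let dn0 : d%:R != 0 :> R. Proof. by rewrite gt_eqF. Qed.

Let dX0 n : d%:R ^+ n != 0 :> R. Proof. by rewrite expf_neq0. Qed.

Let dXV0 n : 0 <= (d%:R ^+ n)^-1 :> R.
Proof. by rewrite invr_ge0 exprn_ge0 ?ltW. Qed.

Let err n : R := C / d%:R ^+ n.

(** Since 2 <= d, the increment C / d^(n+1) is at most C / d^n - C / d^(n+1);
    in this telescoping form the bounds add up to C / d^n. *)
Lemma log_iterS_near n (l : M) (x : 'CV[R]_k.+1) : x != 0 ->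
  `|log_iter n.+1 l x - log_iter n l x| <= err n - err n.+1.
Proof.
move=> x0; have y0 : Fn n l x != 0 by rewrite fiber_iter_eq0.
rewrite /log_iter /= exprS; have := CP (iter n sigma l) y0.
set A := ln _; set B := ln _ => H.
have -> : (d%:R * d%:R ^+ n)^-1 * A - (d%:R ^+ n)^-1 * B =
   (A - d%:R * B) / d%:R ^+ n.+1.
  by rewrite exprS; field; rewrite ?dX0 ?dn0.
rewrite normrM [X in _ * X]ger0_norm//.
rewrite (@le_trans _ _ (C / d%:R ^+ n.+1))// ?ler_wpM2r//.
rewrite /err [leRHS](_ : _ = (d%:R - 1) * (C / d%:R ^+ n.+1)); last first.
  by rewrite exprS; field; rewrite ?dX0 ?dn0.
rewrite ler_peMl//; first by rewrite mulr_ge0.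
by rewrite lerBrDr; have : 2 <= d%:R :> R by rewrite ler_nat.
Qed.

(** The limit of log_iter, obtained as the point common to the nested intervals
    centred at log_iter n with radius err n; it is meaningful for x <> 0. *)
Definition green (l : M) (x : 'CV[R]_k.+1) : R :=
  sup (range (fun n => log_iter n l x - err n)).

Lemma green_near n (l : M) (x : 'CV[R]_k.+1) : x != 0 ->
  `|green l x - log_iter n l x| <= err n.
Proof.
move=> x0; rewrite ler_distl.
have e0 m : 0 <= err m by rewrite mulr_ge0.
apply: (@nested_sup _ (fun n => log_iter n l x - err n) (fun n => log_iter n l x + err n)) => m.
- have := log_iterS_near m l x0; rewrite ler_norml => /andP[]; lra.
- have := log_iterS_near m l x0; rewrite ler_norml => /andP[]; lra.
- have := e0 m; lra.
Qed.

(** Identities between limits are checked on the approximations. *)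
Lemma eq_of_err (a b K : R) : 0 <= K -> (forall n, `|a - b| <= K * err n) -> a = b.
Proof.
move=> K0 H; apply/eqP; rewrite -subr_eq0 -normr_le0; apply/ler_addgt0Pr => e e0.
have [|n nP] := @geometric_small _ d C _ d_ge2 (_ : 0 < e / (K + 1));
  first by rewrite divr_gt0// ltr_wpDl.
rewrite add0r (le_trans (H n))// (le_trans (ler_wpM2l K0 (ltW (nP n (leqnn n)))))//.
rewrite mulrCA ler_piMr//; first exact: ltW.
by rewrite ler_pdivrMr ?ltr_wpDl// mul1r lerDl.
Qed.

Lemma greenZ (l : M) (c : R[i]) (x : 'CV[R]_k.+1) : c != 0 -> x != 0 ->
  green l (c *: x) = ln (cmod c) + green l x.
Proof.
move=> c0 x0; apply: (@eq_of_err _ _ 2) => // n.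
have cx0 : c *: x != 0 by rewrite scaler_eq0 negb_or c0.
have h1 := green_near n l cx0; have h2 := green_near n l x0.
have E : log_iter n l (c *: x) = ln (cmod c) + log_iter n l x.
  rewrite /log_iter fiber_iterZ enormZ lnM ?posrE ?enorm_gt0 ?cmod_gt0 ?fiber_iter_eq0 ?expf_neq0//.
  rewrite cmodX lnXn ?cmod_gt0// mulrDr -[ln (cmod c) *+ _]mulr_natl mulrA natrX mulVf ?mul1r//.
by move: h1 h2; rewrite E !ler_norml => /andP[? ?] /andP[? ?]; apply/andP; split; lra.
Qed.

Lemma green_invariant (l : M) (x : 'CV[R]_k.+1) : x != 0 ->
  d%:R * green l x = green (sigma l) (F l x).
Proof.
move=> x0; apply: (@eq_of_err _ _ 2) => // n.
have y0 : F l x != 0 by rewrite lift_eq0.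
have h1 := green_near n.+1 l x0; have h2 := green_near n (sigma l) y0.
have E : log_iter n (sigma l) (F l x) = d%:R * log_iter n.+1 l x.
  rewrite /log_iter fiber_iterS exprS; field.
  by rewrite ?dX0 ?dn0.
have e' : err n = d%:R * err n.+1.
  by rewrite /err exprS; field; rewrite ?dX0 ?dn0.
have h1' : `|d%:R * green l x - d%:R * log_iter n.+1 l x| <= err n.
  by rewrite -mulrBr normrM gtr0_norm// e' ler_pM2l.
move: h1' h2; rewrite E !ler_norml => /andP[? ?] /andP[? ?]; apply/andP; split; lra.
Qed.

Lemma log_iter_continuous n (l : M) (x : 'CV[R]_k.+1) : x != 0 ->
  continuous_at (l, x) (fun q : M * 'CV[R]_k.+1 => log_iter n q.1 q.2).
Proof.
move=> x0; apply: cvgMr.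
apply: (@continuous_comp _ _ _ (fun q : M * 'CV[R]_k.+1 => Fn n q.1 q.2)
    (fun y => ln (enorm y))); first exact: fiber_iter_continuous.
apply: (@continuous_comp _ _ _ (@enorm R k.+1) (@ln R)).
  exact: enorm_continuous.
by apply: continuous_ln; rewrite enorm_gt0 /= fiber_iter_eq0.
Qed.

Lemma nbhs_neq0 (l : M) (x : 'CV[R]_k.+1) : x != 0 ->
  \forall q \near (l : M, x : 'CV[R]_k.+1), q.2 != 0.
Proof.
move=> x0; suff : \forall y \near x, y != 0.
  by move=> h; exists (setT, [set y | y != 0]) => /=; [split=> //; exact: filterT|case=> ? ? []].
apply/nbhs_enormP; exists (enorm x); first by rewrite enorm_gt0.
move=> y; apply: contraTneq => ->.
by rewrite sub0r -scaleN1r enormZ cmodN cmod1 mul1r ltxx.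
Qed.

Lemma green_continuous (l : M) (x : 'CV[R]_k.+1) : x != 0 ->
  continuous_at (l, x) (fun q : M * 'CV[R]_k.+1 => green q.1 q.2).
Proof.
move=> x0; apply/cvgrPdist_lt => e e0.
have [|n nP] := @geometric_small _ d C _ d_ge2 (_ : 0 < e / 3); first by rewrite divr_gt0.
have en : err n < e / 3 := nP n (leqnn n).
have e30 : 0 < e / 3 by rewrite divr_gt0.
have /cvgrPdist_lt/(_ _ e30) := @log_iter_continuous n l x x0.
have := nbhs_neq0 l x0; apply: filterS2 => -[m y] /= y0 ly.
have h1 := green_near n l x0; have h2 := green_near n m y0.
move: h1 h2 ly; rewrite !ler_norml !ltr_norml.
by move=> /andP[? ?] /andP[? ?] /andP[? ?]; apply/andP; split; lra.
Qed.

(** By homogeneity the difference depends only on the direction of x, so it is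
    enough to be uniform on the sphere, which is compact. *)
Lemma green_unif_near (l : M) e : 0 < e ->
  \forall l' \near l, forall x, x != 0 -> `|green l' x - green l x| <= e.
Proof.
move=> e0; have e20 : 0 < e / 2 by rewrite divr_gt0.
have /compact_near_coveringP cS := @compact_unit_sphere R k.+1.
have : \forall l' \near l, [set x : 'CV[R]_k.+1 | enorm x = 1] `<=`
    (fun x => `|green l' x - green l x| <= e).
  apply: (cS M (nbhs l) (fun l' x => `|green l' x - green l x| <= e)) => x x1.
  have x0 : x != 0 by rewrite -enorm_gt0 x1.
  have /cvgrPdist_lt/(_ _ e20)[[A B] /= [lA xB] AB] := @green_continuous l x x0.
  exists (B, A) => //= -[y l'] /= [By Al'].
  have h1 := AB (l', y) (conj Al' By); have h2 := AB (l, y) (conj (nbhs_singleton lA) By).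
  move: h1 h2; rewrite /= ler_norml !ltr_norml => /andP[? ?] /andP[? ?].
  by apply/andP; split; lra.
apply: filterS => l' H x x0; have n0 : 0 < enorm x by rewrite enorm_gt0.
pose y := ((enorm x)^-1)%:C%C *: x.
have y1 : enorm y = 1.
  by rewrite enormZ cmod_real gtr0_norm ?invr_gt0// mulVf// gt_eqF.
have c0 : ((enorm x)^-1)%:C%C != 0 by rewrite -cmod_gt0 cmod_real normr_gt0 invr_eq0 gt_eqF.
by have := H y y1; rewrite /y !greenZ// opprD addrACA subrr add0r.
Qed.

(** The norm of the n-th iterate is exp(d^n G(x)) up to a factor exp(C). If
    G(x) < 0 it tends to 0; otherwise it stays above exp(-C). *)
Lemma green_basin (l : M) (x : 'CV[R]_k.+1) : x != 0 ->
  (green l x < 0) <-> (Fn n l x @[n --> \oo] --> (0 : 'CV[R]_k.+1)).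
Proof.
move=> x0.
have H n : `|green l x * d%:R ^+ n - ln (enorm (Fn n l x))| <= C.
  have -> : green l x * d%:R ^+ n - ln (enorm (Fn n l x)) =
      (green l x - log_iter n l x) * d%:R ^+ n.
    by rewrite /log_iter; field; rewrite ?dX0 ?dn0.
  rewrite normrM [X in _ * X]gtr0_norm ?exprn_gt0// -ler_pdivlMr ?exprn_gt0//.
  exact: green_near.
have Fn0 n : 0 < enorm (Fn n l x) by rewrite enorm_gt0 fiber_iter_eq0.
split=> [g0 P /nbhs_enormP[e e0 eP]|Fx0].
  have [|n nP] := @geometric_small _ d (C - ln e) (- green l x) d_ge2.
    by rewrite oppr_gt0.
  exists n => // m /= nm; apply: eP; rewrite subr0 -ltr_ln ?posrE//.
  have := nP m nm; rewrite ltr_pdivrMr ?exprn_gt0//.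
  by have := H m; rewrite ler_norml => /andP[]; lra.
have : nbhs (0 : 'CV[R]_k.+1) [set y | enorm y < expR (- C)].
  by apply/nbhs_enormP; exists (expR (- C)); [exact: expR_gt0|move=> y; rewrite subr0].
move=> /Fx0[n _ /(_ n (leqnn n))]; rewrite /= -[X in X < _]lnK ?posrE// ltr_expR => h.
rewrite ltNge; apply/negP => g0; have := H n; rewrite ler_norml => /andP[].
have : 0 <= green l x * d%:R ^+ n by rewrite mulr_ge0// exprn_ge0// ltW.
by lra.
Qed.

End Green.

(** * Uniform limits of logarithms of holomorphic maps *)

(** max(x, -K) as a real number. Truncation makes a function with values in
    [-oo, +oo[ continuous and real-valued, hence usable as a majorant. *)
Definition truncate (R : realType) (K : R) (x : \bar R) : R :=
  fine (maxe x (- K)%:E).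

Lemma truncate_fin (R : realType) (K r : R) : truncate K r%:E = Num.max r (- K).
Proof. by rewrite /truncate -EFin_max. Qed.

Lemma truncate_Ny (R : realType) (K : R) : truncate K -oo%E = - K.
Proof. by rewrite /truncate maxNye. Qed.

Lemma truncate_ge (R : realType) (K : R) (x : \bar R) : (x < +oo)%E ->
  (x <= (truncate K x)%:E)%E.
Proof.
by case: x => [r| |]// _; rewrite ?leNye// truncate_fin lee_fin le_max lexx.
Qed.

Lemma truncate_continuous (R : realType) (T : topologicalType) (K : R)
    (v : T -> \bar R) (t : T) :
  (v t < +oo)%E -> continuous_at t v ->
  continuous_at t (fun s => truncate K (v s)).
Proof.
rewrite /continuous_at; case E : (v t) => [r| |]// _.
  rewrite truncate_fin => /fine_cvgP[vfin /cvgrPdist_lt vr].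
  apply/cvgrPdist_lt => e e0; have := vr e e0; move: vfin.
  apply: filterS2 => s /= vs rs; rewrite -(fineK vs) truncate_fin.
  apply: le_lt_trans rs; set a := fine _.
  rewrite ler_norml /Num.max; have := ler_norm (r - a); have := ler_norm (a - r).
  rewrite (distrC a); case: (ltP r) => ?; case: (ltP a) => ? *;
    by apply/andP; split; lra.
move=> /cvgeNyPlt/(_ (- K)) vK; apply/cvgrPdist_lt => e e0.
apply: filterS vK => s /= vs; rewrite truncate_Ny.
case: (v s) vs => [r| |]//; last by rewrite truncate_Ny subrr normr0.
by rewrite lte_fin truncate_fin => /ltW/max_idPr->; rewrite subrr normr0.
Qed.

(** The truncations have the positive part of v, and their negative parts
    min(v^-, K) increase to v^-, so monotone convergence applies to the negative
    parts; the lower bound c bounds their integrals. *)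
Lemma integral_ge_truncate (R : realType) (v : R -> \bar R) (a b c : R) :
  continuous v -> (forall t, (v t < +oo)%E) ->
  (forall K : nat, c <= \int[lebesgue_measure]_(t in `[a, b]) truncate K%:R (v t)) ->
  (c%:E <= \int[lebesgue_measure]_(t in `[a, b]) v t)%E.
Proof.
move=> cv voo Hc.
pose f (K : nat) (t : R) := (truncate K%:R (v t))%:E.
have cf (K : nat) : continuous (fun t => truncate K%:R (v t)).
  by move=> t; apply: truncate_continuous => //; exact: cv.
have fi K : lebesgue_measure.-integrable `[a, b] (f K).
  exact: (continuous_itv_integrable a b (@cf K)).
have K0 (K : nat) : - K%:R <= 0 :> R by rewrite oppr_le0.
have pos K t : (f K)^\+%E t = v^\+%E t.
  rewrite !funeposE /f; have := voo t; case: (v t) => [r| |]// _.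
    by rewrite truncate_fin -!EFin_max; congr EFin; rewrite -maxA (max_r (K0 K)).
  by rewrite truncate_Ny -EFin_max maxNye (max_r (K0 K)).
have neg K t : (f K)^\-%E t = mine (v^\-%E t) K%:R%:E.
  rewrite !funenegE /f; have := voo t; case: (v t) => [r| |]// _.
    rewrite truncate_fin -EFinN -!EFin_max -EFin_min; congr EFin.
    have := K0 K.
    rewrite /Num.max /Num.min; case: (ltP r) => h1; case: (ltP (- _) 0) => h2;
      try (case: (ltP (- r) 0) => h3); case: ifP => h4; lra.
  rewrite truncate_Ny -EFinN opprK -EFin_max max_l// /= maxye minye//.
set I := `[a, b]%classic.
pose A := fine (\int[lebesgue_measure]_(t in I) v^\+%E t).
have AE : (\int[lebesgue_measure]_(t in I) v^\+%E t = A%:E)%E.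
  rewrite fineK//; under eq_integral do rewrite -(pos 0%N).
  by apply: (@integrable_pos_fin_num _ _ _ _ _ _ _ (fi 0%N)).
have NK K : (\int[lebesgue_measure]_(t in I) (f K)^\-%E t <= (A - c)%:E)%E.
  have Nfin : (\int[lebesgue_measure]_(t in I) (f K)^\-%E t)%E \is a fin_num.
    by apply: (@integrable_neg_fin_num _ _ _ _ _ _ _ (fi K)).
  rewrite -(fineK Nfin) lee_fin lerBrDr addrC -lerBrDr.
  have := Hc K; rewrite /Rintegral integralE.
  by under eq_integral do rewrite pos; rewrite AE -(fineK Nfin).
have mono t : {homo (fun K => (f K)^\-%E t) : n m / (n <= m)%N >-> (n <= m)%E}.
  by move=> n m nm; rewrite !neg; apply: le_min2 => //; rewrite lee_fin ler_nat.
have lim t : limn (fun K => (f K)^\-%E t) = v^\-%E t.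
  have := voo t; case E : (v t) => [r| |]// _.
    apply: lim_near_cst => //; near=> K.
    rewrite neg funenegE E min_l// ge_max -EFinN !lee_fin ler0n andbT.
    near: K; exact: nbhs_infty_ger.
  have -> : v^\-%E t = +oo%E by rewrite funenegE E maxye.
  apply/cvg_lim => //; rewrite (_ : (fun K : nat => _) = (fun K : nat => K%:R%:E)).
    exact/(@cvgenyP R _ _ _ id)/cvg_id.
  by apply/funext => K; rewrite neg funenegE E maxye minye.
have H : (\int[lebesgue_measure]_(t in I) (f K)^\-%E t)%E @[K --> \oo] -->
    (\int[lebesgue_measure]_(t in I) limn (fun K => (f K)^\-%E t))%E.
  apply: cvg_monotone_convergence => //.
  - exact: measurable_itv.
  - move=> n; apply: measurable_realfun.measurable_funeneg.
    exact: (measurable_int _ (fi n)).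
have N : (\int[lebesgue_measure]_(t in I) v^\-%E t <= (A - c)%:E)%E.
  under eq_integral do rewrite -lim.
  rewrite -(cvg_lim _ H)//; apply: lime_le; first exact: cvgP H.
  apply: nearW => n; exact: NK.
rewrite integralE AE.
apply: le_trans (leeB (lexx _) N).
by rewrite -EFinB lee_fin; lra.
Unshelve. all: by end_near.
Qed.

Lemma expit_continuous (R : realType) : continuous (@expit R).
Proof.
by move=> t; apply: complex_continuous; [exact: continuous_cos|exact: continuous_sin].
Qed.

Lemma circle_continuous (R : realType) n (z w : 'CV[R]_n) :
  continuous (fun t : R => z + expit t *: w).
Proof.
move=> t; apply: (@continuous_comp _ _ _ (@expit R) (fun c : R[i] => z + c *: w)).
  exact: expit_continuous.
apply: differentiable_continuous; apply: differentiableD; first exact: differentiable_cst.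
exact: differentiableZl.
Qed.

(** The submean inequality for u on a circle follows from le_exp_mean applied to
    H j with the majorant m j (max(u, -K) + e/2), first letting e tend to 0 and
    then K to infinity. *)
Lemma plurisubharmonic_log_limit (R : realType) n p (u : 'CV[R]_n -> \bar R)
    (m : nat -> R) (H : nat -> 'CV[R]_n -> 'CV[R]_p) :
  (forall j, 0 < m j) -> (forall j, holomorphic (H j)) ->
  continuous u -> (forall x, (u x < +oo)%E) ->
  uniform_cvg_on [set: 'CV[R]_n]
    (fun j x => ((m j)^-1%:E * lne (enorm (H j x))%:E)%E) u ->
  plurisubharmonic u.
Proof.
move=> m0 dH cu uoo uH; split=> // [x a|z w].
  move=> ua; exists [set y | (u y < (- a)%:E)%E].
    apply: (cu x [set y | (y < (- a)%:E)%E]); apply: open_nbhs_nbhs; split.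
      exact: open_ereal_lt_ereal.
    by rewrite /= EFinN lteNr.
  by move=> y /=; rewrite EFinN lteNr.
have pi0 : 0 < 2 * pi :> R by rewrite mulr_gt0// pi_gt0.
pose v t := u (z + expit t *: w).
have cv : continuous v.
  by move=> t; apply: continuous_comp; [exact: circle_continuous|exact: cu].
have voo t : (v t < +oo)%E by exact: uoo.
have [->|uz] := eqVneq (u z) -oo%E; first exact: leNye.
have [g ug] : exists g, u z = g%:E.
  by move: uz (uoo z); case: (u z) => [r _ _| |]//; exists r.
rewrite ug lee_pdivlMl// -EFinM; apply: integral_ge_truncate => // K.
rewrite -ler_pdivlMl//; set Phi := fun t => truncate K%:R (v t).
have cPhi : continuous Phi.
  by move=> t; apply: truncate_continuous => //; exact: cv.
set J := \int[_]_(_ in _) _.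
apply/ler_addgt0Pr => e e0.
have e20 : 0 < e / 2 by rewrite divr_gt0.
have [N _ /(_ N (leqnn N)) uN] := uH _ e20.
have lnu x y : ((m N)^-1%:E * lne (enorm (H N x))%:E <= y%:E)%E ->
    enorm (H N x) <= expR (m N * y).
  have [->|h0] := eqVneq (enorm (H N x)) 0; first by rewrite expR_ge0.
  have hp : 0 < enorm (H N x) by rewrite lt_neqAle eq_sym h0 enorm_ge0.
  rewrite lne_EFin// -EFinM lee_fin ler_pdivrMl// => h.
  by rewrite -[leLHS]lnK ?posrE// ler_expR.
have up : enorm (H N z) <= expR (m N * ((2 * pi)^-1 * J + e / 2)).
  have -> : m N * ((2 * pi)^-1 * J + e / 2) =
     (2 * pi)^-1 * \int[lebesgue_measure]_(t in `[0, 2 * pi]) (m N * (Phi t + e / 2)).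
    have cst_int : lebesgue_measure.-integrable `[0, 2 * pi] (EFin \o (fun=> e / 2)).
      by apply: continuous_itv_integrable => x; exact: cst_continuous.
    rewrite RintegralZl//; last first.
      apply: continuous_itv_integrable => x; apply: cvgD; first exact: cPhi.
      exact: cst_continuous.
    rewrite RintegralD//; last exact: continuous_itv_integrable.
    rewrite Rintegral_cst//= lebesgue_measure_itv/= lte_fin pi0/= subr0 -/J.
    by rewrite mulrCA [_^-1 * (J + _)]mulrDr [_^-1 * (e / 2 * _)]mulrCA mulVf ?mulr1// gt_eqF.
  apply: (enorm_line_le_exp_mean (w := w) (dH N)).
  - move=> t; apply: cvgMr; apply: cvgD; first exact: cPhi.
    exact: cst_continuous.
  - by move=> t; rewrite /Phi /v expit_periodic.
  - move=> t; apply: lnu; have [_ h] := uN (z + expit t *: w) I.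
    apply: (le_trans h); rewrite EFinD; apply: leeD => //.
    exact: truncate_ge.
have [h _] := uN z I; rewrite ug in h.
have hz : 0 < enorm (H N z).
  rewrite lt_neqAle enorm_ge0 andbT eq_sym; apply/eqP => z0.
  by move: h; rewrite z0 le0_lneNy// mulrNy ?gtr0_sg ?invr_gt0// mul1e leeNy_eq.
move: up; rewrite -ler_ln ?posrE ?expR_gt0// expRK => up.
move: h; rewrite lne_EFin// -EFinM -EFinB lee_fin ler_pdivlMl// => h.
have := le_trans h up; rewrite ler_pM2l//; lra.
Qed.

(** * The main statement *)

Lemma fiber_iter_holomorphic (R : realType) (M : Type) (sigma : M -> M) k
    (F : M -> 'CV[R]_k.+1 -> 'CV[R]_k.+1) n l :
  (forall l, holomorphic (F l)) -> holomorphic (fiber_iter sigma F n l).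
Proof.
move=> dF; elim: n => [|n IH] x; first exact: ex_diff.
by apply: (@differentiable_comp _ _ _ _ (fiber_iter sigma F n l)); [exact: IH|exact: dF].
Qed.

Theorem proposition1p15 (R : realType) (M : metricType R)
    (compM : compact [set: M]) (sigma : M -> M) (sigmaC : continuous sigma)
    (k d : nat) (d_ge2 : (2 <= d)%N)
    (f : M -> proj_space R k -> proj_space R k)
    (f_endo : forall l, holomorphic_endomorphism d (f l))
    (fC : continuous (fun q : M * proj_space R k => f q.1 q.2))
    (F : M -> 'CV[R]_k.+1 -> 'CV[R]_k.+1)
    (F_lift : forall l, homogeneous_lift d (F l) (f l))
    (FC : continuous (fun q : M * 'CV[R]_k.+1 => F q.1 q.2)) :
  exists G : M -> 'CV[R]_k.+1 -> \bar R,
    [/\ forall l, [/\ uniform_cvg_on [set: 'CV[R]_k.+1]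
                        (fun n => Gn d sigma F n l) (G l),
                      continuous (G l),
                      plurisubharmonic (G l) &
                      forall (c : R[i]) (x : 'CV[R]_k.+1), c != 0 ->
                        G l (c *: x) = ((ln (cmod c))%:E + G l x)%E],
        forall l (x : 'CV[R]_k.+1),
          ((d%:R : R)%:E * G l x)%E = G (sigma l) (F l x),
        forall (l : M) (s : nat -> M), s n @[n --> \oo] --> l ->
          locally_uniform_cvg_on [set x : 'CV[R]_k.+1 | x != 0]
            (fun n => G (s n)) (G l) &
        forall l, basin0 sigma F l = [set x | (G l x < 0)%E]].
Proof.
have dF l : holomorphic (F l) by have [] := F_lift l.
have Fhom l : homogeneous_map d (F l) by have [] := F_lift l.
have Fnz l : Defs.nondegenerate (F l) by have [] := F_lift l.
have [C C0 CP] := ln_lift_bound Fhom Fnz FC compM.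
pose g := green sigma d F C.
pose G l x : \bar R := if x == 0 then -oo%E else (g l x)%:E.
have dn0 n : 0 < (d ^ n)%:R :> R by rewrite ltr0n expn_gt0 (leq_trans _ d_ge2).
(* At the origin both G and the approximations are -oo. *)
have G0 l : G l 0 = -oo%E by rewrite /G eqxx.
have Gfin l x : x != 0 -> G l x = (g l x)%:E by rewrite /G => /negPf->.
have F0 l : F l 0 = 0 by apply/eqP; rewrite (lift_eq0 Fnz).
have GnE n l x : x != 0 -> Gn d sigma F n l x = (log_iter sigma d F n l x)%:E.
  by move=> x0; rewrite /Gn lne_EFin ?enorm_gt0 ?(fiber_iter_eq0 sigma Fnz)// -EFinM natrX.
have Gn0 n l : Gn d sigma F n l 0 = -oo%E.
  rewrite /Gn; have -> : fiber_iter sigma F n l 0 = 0 by apply/eqP; rewrite (fiber_iter_eq0 sigma Fnz).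
  by rewrite enorm0 le0_lneNy// mulrNy gtr0_sg ?invr_gt0// mul1e.
have Gunif l : uniform_cvg_on [set: 'CV[R]_k.+1] (fun n => Gn d sigma F n l) (G l).
  move=> e e0; have [N NP] := geometric_small C d_ge2 e0.
  exists N => // n Nn x _; have [->|x0] := eqVneq x 0; first by rewrite Gn0 G0.
  have := green_near sigma d_ge2 Fnz C0 CP n l x0; have := NP n Nn.
  rewrite GnE// Gfin// -EFinB -EFinD !lee_fin ler_norml => ? /andP[? ?].
  by split; rewrite /g; lra.
have Gcont l : continuous (G l).
  move=> x; have [->|x0] := eqVneq x 0.
    rewrite /continuous_at G0.
    apply/(@cvgeNyPlt _ _ _ (nbhs_filter (0 : 'CV[R]_k.+1))) => A.
    apply/nbhs_enormP; exists (expR (A - C)); first exact: expR_gt0.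
    move=> y; rewrite subr0; have [->|y0] := eqVneq y 0; first by rewrite G0 ltNyr.
    rewrite Gfin// lte_fin -[X in X < _]lnK ?posrE ?enorm_gt0// ltr_expR.
    have := green_near sigma d_ge2 Fnz C0 CP 0 l y0.
    rewrite /log_iter expr0 divr1 invr1 mul1r /= ler_norml => /andP[? ?] ?.
    by rewrite /g; lra.
  rewrite /continuous_at (Gfin _ _ x0).
  have /= cg := @green_continuous _ _ _ _ _ _ sigmaC d_ge2 Fnz FC C C0 CP l x x0.
  have /= near0 := nbhs_neq0 l x0.
  have cl : (l, y) @[y --> x] --> (l, x).
    apply: (@cvg_pair _ _ _ (nbhs x) (nbhs l) (nbhs x)); last exact: cvg_id.
    exact: cvg_cst.
  have n0 : \forall y \near x, y != 0 by exact: cl _ near0.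
  apply/(@fine_cvgP _ _ _ (nbhs_filter x)); split.
    by apply: filterS n0 => y y0; rewrite Gfin.
  apply/(@cvgrPdist_lt _ _ _ _ (nbhs_filter x)) => e e0.
  have /cvgrPdist_lt/(_ e e0)/cl := cg.
  by move: n0; apply: filterS2 => y y0 /=; rewrite (Gfin _ _ y0).
exists G; split.
- move=> l; split=> //.
    apply: (@plurisubharmonic_log_limit _ _ _ _ (fun n => (d ^ n)%:R)
      (fun n => fiber_iter sigma F n l)) => //.
    + by move=> n; exact: fiber_iter_holomorphic.
    + by move=> x; rewrite /G; case: ifP; rewrite ?ltNyr ?ltry.
    + exact: Gunif.
  move=> c x c0; have [->|x0] := eqVneq x 0; first by rewrite scaler0 G0.
  have cx0 : c *: x != 0 by rewrite scaler_eq0 negb_or c0.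
  by rewrite !Gfin// /g (greenZ sigma d_ge2 Fhom Fnz C0 CP).
- move=> l x; have [->|x0] := eqVneq x 0.
    by rewrite F0 !G0 mulrNy gtr0_sg ?mul1e// -(expn1 d).
  by rewrite !Gfin ?(lift_eq0 Fnz)// -EFinM /g (green_invariant _ d_ge2 Fnz C0 CP).
- move=> l s sl x x0; exists setT; first exact: filterT.
  move=> e e0.
  have Hn : \forall n \near \oo, forall y, y != 0 -> `|g (s n) y - g l y| <= e.
    exact: sl _ (green_unif_near sigmaC d_ge2 Fhom Fnz FC C0 CP l e0).
  apply: filterS Hn => n H y [_ y0]; have := H y y0.
  rewrite !Gfin// -EFinB -EFinD !lee_fin ler_norml => /andP[? ?].
  by split; lra.
- move=> l; apply/seteqP; split=> x /=; rewrite /basin0 /=.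
    have [->|x0] := eqVneq x 0; first by rewrite G0 ltNyr.
    by move=> /(green_basin sigma d_ge2 Fnz C0 CP l x0); rewrite Gfin// lte_fin.
  have [->|x0] := eqVneq x 0; last first.
    by rewrite Gfin// lte_fin; exact: (green_basin sigma d_ge2 Fnz C0 CP l x0).1.
  move=> _; rewrite (_ : (fun n => _) = cst 0); first exact: cvg_cst.
  by apply/funext => n; apply/eqP; rewrite (fiber_iter_eq0 sigma Fnz).
Qed.
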